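(* The CF-Overlap Number problem is NP-complete.
   Context: Two sets overlap if they intersect and neither is a subset of the other. An overlap representation of a graph $G=(V,E)$ is a family (multiset) of finite sets $\{S_v : v\in V\}$ such that for all $u,v\in V$, $(u,v)\in E$ iff $S_u\cap S_v\neq\emptyset$, $S_u\not\subseteq S_v$ and $S_v\not\subseteq S_u$; its size is $|\bigcup_v S_v|$. It is containment-free if for no two distinct vertices $u\neq v$ is $S_u\subseteq S_v$. The CF-Overlap Number problem: Instance: a graph $G=(V,E)$ and a natural number $k$. Question: does $G$ have a containment-free overlap representation of size $k$? *)

(* Defs.v *)
From mathcomp Require Import all_boot.

Set Implicit Arguments.
Unset Strict Implicit.
Unset Printing Implicit Defensive.

(* Deterministic multitape Turing machines with two-way infinite tapes. *)

Inductive move := MoveL | MoveR | Stay.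

(* There are tapes.+1 tapes.  A tape symbol is the blank [None], an input bit
   [Some (inl b)], or a machine-specific work symbol [Some (inr a)]. *)
Record tm := TM {
  state : finType;
  work : finType;
  tapes : nat;
  start : state;
  halting : pred state;
  accepting : pred state;
  delta : state -> {ffun 'I_tapes.+1 -> option (bool + work)} ->
          state * ('I_tapes.+1 -> option (bool + work) * move)
}.

Definition symbol (M : tm) : Type := option (bool + work M).

(* [left] lists the cells to the left of the head, nearest first; all cells
   beyond the two lists are blank. *)
Record tape (M : tm) := Tape {
  left : seq (symbol M);
  cell : symbol M;
  right : seq (symbol M)
}.

Definition write (M : tm) (a : symbol M) (t : tape M) : tape M :=
  Tape (left t) a (right t).

Definition shift (M : tm) (d : move) (t : tape M) : tape M :=
  match d with
  | MoveL => Tape (behead (left t)) (head None (left t)) (cell t :: right t)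
  | MoveR => Tape (cell t :: left t) (head None (right t)) (behead (right t))
  | Stay => t
  end.

Record config (M : tm) := Config {
  cstate : state M;
  ctape : 'I_(tapes M).+1 -> tape M
}.

Definition halted (M : tm) (c : config M) : bool := halting (cstate c).

(* Halted configurations are fixed points, so a machine halts within t steps
   iff its t-th configuration is halted. *)
Definition step (M : tm) (c : config M) : config M :=
  if halted c then c else
  let: (q, act) := delta (cstate c) [ffun i => cell (ctape c i)] in
  Config q (fun i => shift (act i).2 (write (act i).1 (ctape c i))).

Definition string_tape (M : tm) (w : seq bool) : tape M :=
  let s := [seq Some (inl b) | b <- w] : seq (symbol M) in
  Tape [::] (head None s) (behead s).

(* The i-th input string is written on tape i, with the head on its first
   symbol; the remaining tapes are blank. *)
Definition initial (M : tm) (ws : seq (seq bool)) : config M :=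
  Config (start M) (fun i => string_tape M (nth [::] ws i)).

Definition run (M : tm) (ws : seq (seq bool)) (t : nat) : config M :=
  iter t (@step M) (initial M ws).

Fixpoint leading_bits (W : Type) (s : seq (option (bool + W))) : seq bool :=
  if s is Some (inl b) :: s' then b :: leading_bits s' else [::].

(* The output is the longest string of bits on tape 0 that starts at the
   head and extends to the right. *)
Definition output (M : tm) (c : config M) : seq bool :=
  leading_bits (cell (ctape c ord0) :: right (ctape c ord0)).

(* Every polynomial with natural coefficients is dominated by one of these. *)
Definition poly_bound (c d n : nat) : nat := c * n ^ d + c.

Definition language := seq bool -> Prop.

Definition polytime_computable (f : seq bool -> seq bool) : Prop :=
  exists (M : tm) (c d : nat), forall x : seq bool,
    let final := run M [:: x] (poly_bound c d (size x)) in
    halted final /\ output final = f x.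

Definition polytime_reducible (A B : language) : Prop :=
  exists2 f : seq bool -> seq bool,
    polytime_computable f & forall x : seq bool, A x <-> B (f x).

(* The verifier reads the instance x on tape 0 and the certificate y on
   tape 1. *)
Definition NP (A : language) : Prop :=
  exists (M : tm) (c d e f : nat),
    let final x y := run M [:: x; y] (poly_bound c d (size x + size y)) in
    (forall x y : seq bool, halted (final x y)) /\
    (forall x : seq bool, A x <->
       exists y : seq bool,
         size y <= poly_bound e f (size x) /\ accepting (cstate (final x y))).

Definition NP_hard (B : language) : Prop :=
  forall A : language, NP A -> polytime_reducible A B.

Definition NP_complete (B : language) : Prop := NP B /\ NP_hard B.

(* Strings that encode no instance are outside the language. *)
Definition problem_language (I : Type) (encode : I -> seq bool)
    (yes : I -> Prop) : language :=
  fun w => exists2 x : I, encode x = w & yes x.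

Record graph := Graph {
  order : nat;
  adj : rel 'I_order;
  adj_sym : symmetric adj;
  adj_irr : irreflexive adj
}.

Definition overlap (U : finType) (A B : {set U}) : bool :=
  [&& A :&: B != set0, ~~ (A \subset B) & ~~ (B \subset A)].

Definition overlap_representation (G : graph) (U : finType)
    (S : 'I_(order G) -> {set U}) : Prop :=
  forall u v : 'I_(order G), adj u v = overlap (S u) (S v).

Definition representation_size (G : graph) (U : finType)
    (S : 'I_(order G) -> {set U}) : nat :=
  #|\bigcup_(v : 'I_(order G)) S v|.

Definition containment_free (G : graph) (U : finType)
    (S : 'I_(order G) -> {set U}) : Prop :=
  forall u v : 'I_(order G), u != v -> ~~ (S u \subset S v).

(* A family of finitely many finite sets lives in some finite type U, so
   quantifying over U loses no generality. *)
Definition cf_overlap_number (x : graph * nat) : Prop :=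
  exists (U : finType) (S : 'I_(order x.1) -> {set U}),
    [/\ overlap_representation S, containment_free S &
        representation_size S = x.2].

(* Least significant bit first, without leading zeros: k has
   up_log 2 k.+1 binary digits. *)
Definition binary (k : nat) : seq bool :=
  mkseq (fun i => odd (k %/ 2 ^ i)) (up_log 2 k.+1).

(* The order in unary, a separator, the adjacency matrix in row-major order,
   and then k in binary. *)
Definition encode_instance (x : graph * nat) : seq bool :=
  let: (G, k) := x in
  nseq (order G) true ++ false ::
  [seq adj i j | i <- enum 'I_(order G), j <- enum 'I_(order G)] ++ binary k.

Definition cf_overlap_language : language :=
  problem_language encode_instance cf_overlap_number.

Lemma binary_inj : injective binary.
Proof.
have bit0 k i : k < 2 ^ i -> nth false (binary k) i = odd (k %/ 2 ^ i).
  move=> lt_k; rewrite divn_small // nth_default // size_mkseq.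
  by apply: up_log_min.
have bitE k i : nth false (binary k) i = odd (k %/ 2 ^ i).
  have [lt_i|le_i] := ltnP i (up_log 2 k.+1); first by rewrite nth_mkseq.
  apply: bit0; apply: (@leq_trans (2 ^ up_log 2 k.+1)).
    by apply: up_logP.
  by rewrite leq_exp2l.
move=> k l eq_kl.
have {bit0} bits i : odd (k %/ 2 ^ i) = odd (l %/ 2 ^ i).
  by rewrite -!bitE eq_kl.
elim/ltn_ind: k l {eq_kl} bits => k IHk l bits.
have odd_kl : odd k = odd l by have := bits 0; rewrite !divn1.
case: (posnP k) => [k0|k_gt0].
  case: (posnP l) => [->//|l_gt0].
  have := bits (trunc_log 2 l); rewrite k0 div0n.
  have /andP[lo hi] := @trunc_log_bounds 2 l isT l_gt0.
  suff -> : l %/ 2 ^ trunc_log 2 l = 1 by [].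
  apply/eqP; rewrite eqn_leq -ltnS ltn_divLR ?expn_gt0 // -expnS hi /=.
  by rewrite divn_gt0 ?expn_gt0.
rewrite -(odd_double_half k) -(odd_double_half l) odd_kl; congr (_ + _.*2).
apply: IHk; first by rewrite -divn2 ltn_Pdiv.
by move=> i; rewrite -!divn2 -!divnMA -!expnS.
Qed.

(* The encoding determines the answer. *)
Lemma cf_overlap_languageP (x : graph * nat) :
  cf_overlap_language (encode_instance x) <-> cf_overlap_number x.
Proof.
split=> [[y]|]; last by exists x.
case: y x => [[n a sa ia] k] [[m b sb ib] l] /=.
have unary : forall n m s t, nseq n true ++ false :: s = nseq m true ++ false :: t
    -> n = m /\ s = t.
  by elim=> [|p IHp] [|q] //= s t [] // /IHp[-> ->].
move=> /unary[eq_nm]; case: m / eq_nm b sb ib => b sb ib.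
move=> eq_ts; have {eq_ts} := introT eqP eq_ts.
rewrite eqseq_cat ?size_allpairs // => /andP[/eqP eq_ab /eqP/binary_inj <-].
have {}eq_ab i j : a i j = b i j.
  have rows s t : [seq a i j | i <- s, j <- t] = [seq b i j | i <- s, j <- t] ->
      i \in s -> j \in t -> a i j = b i j.
    elim: s => // p s IHs /= eq_st i_s j_t; move/eqP: eq_st.
    rewrite eqseq_cat ?size_map // => /andP[/eqP/eq_in_map eq_row /eqP eq_rest].
    by case/predU1P: i_s => [->|i_s]; [apply: eq_row | apply: IHs].
  by apply: (rows _ _ eq_ab); rewrite mem_enum.
case=> U [S [/= repS cfS szS]]; exists U, S; split=> //= u v.
by apply: (etrans (esym (eq_ab u v))); apply: repS.
Qed.

(* Main.v *)
Require Import Defs.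
From mathcomp Require Import all_boot.
From Stdlib Require Import FunctionalExtensionality.
From mathcomp Require Import zify.
Import Defs.

(** An element of a representation is the clique of the vertices whose sets
    contain it, so a containment-free overlap representation of size k is a
    cover of the edges by k cliques in which every vertex u lies in some clique
    avoiding v, for all v <> u.

    Membership: n^2 elements always suffice and, for n > 0, any representation
    can be padded, so an n by min(n^2, k) incidence matrix is a certificate.

    Hardness: a graph H on N vertices is k-colorable iff its complement joined
    to an independent set of N^2 + 1 vertices has a representation of size
    (N^2 + 1) k + N^2.  The cliques through distinct independent vertices are
    distinct, so one of those vertices lies in at most k cliques, and these
    color H; the additional N^2 elements pay for the edges of the complement
    and for containment-freeness.  Coloring is reached from the computation
    tableau of an NP verifier without passing through 3-SAT: the colors are all
    pairs (variable, value), each color occurs on a vertex of a clique, a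
    variable vertex may only take its own colors, and the vertex of a clause,
    adjacent to all variable vertices, may only take the literals of the clause;
    it can be colored iff one of them differs from the chosen value.

    Both the reduction and the verifier are computed by a small language of
    programs on stacks: a stack is the part of a tape from the head rightwards,
    so that pushing and popping are moves of the head. *)

Set Implicit Arguments.
Unset Strict Implicit.
Unset Printing Implicit Defensive.

(** * Stack programs and their compilation to Turing machines *)

(** The numbers are tuned for a pigeonhole argument: if each of the N^2 + 1 independent vertices lay
    in at least k + 1 cliques, these would number (N^2 + 1) k + N^2 + 1, one more than the size
    allows. The slack of N^2, one element per ordered pair of vertices, thus dictates how many
    independent vertices are taken.

    The tableau is described by forbidden local patterns, that is, conjunctions of equations between
    a variable and a value. Their negations are clauses that ask for a violated literal, and no
    clause has to say that an entry has exactly one value, because an assignment is a function.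
    Tapes are recorded relative to their heads, so that no head position has to be encoded.

    There are as many colors as vertices in the color clique, so a coloring restricts to a bijection
    on it and colors can be identified with literals.

    Programs compute in unary, so every intermediate value must be polynomial. The k of an instance
    is written in binary and may be exponential in the input length; this is why the verifier
    computes only min(n^2, k). *)

Inductive prog :=
  | Push of nat & bool
  | Pop of nat
  | Seq of prog & prog
  | Case of nat & prog & prog & prog
  | While of nat & prog.

(** A transition writes before it moves, so a push takes two instructions: [IUp] steps to the left
    of the top and [ISet] writes there. [IPop] erases nothing; the bit it leaves behind is
    overwritten by a later push. *)
Inductive instr :=
  | IUp of nat
  | ISet of nat & bool
  | IPop of nat
  | IJump of nat & nat & nat & nat.

Definition ireg (a : instr) : nat :=
  match a with IUp r | ISet r _ | IPop r | IJump r _ _ _ => r end.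

Fixpoint csize (P : prog) : nat :=
  match P with
  | Push _ _ => 2
  | Pop _ => 1
  | Seq P Q => csize P + csize Q
  | Case _ P Q R => (csize P + csize Q + csize R + 3)
  | While _ P => csize P + 2
  end.

(** An unconditional jump is an [IJump] with three equal targets. The last branch of [Case] falls
    through and needs none. *)
Fixpoint compile (P : prog) (o : nat) : seq instr :=
  match P with
  | Push r b => [:: IUp r; ISet r b]
  | Pop r => [:: IPop r]
  | Seq P Q => compile P o ++ compile Q (o + csize P)
  | Case r P Q R =>
    let oP := o.+1 in
    let oQ := (oP + csize P).+1 in
    let oR := (oQ + csize Q).+1 in
    let e := oR + csize R in
    IJump r oP oQ oR :: compile P oP ++ IJump r e e e ::
      compile Q oQ ++ IJump r e e e :: compile R oR
  | While r P =>
    let e := o + csize P + 2 in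
    IJump r e o.+1 o.+1 :: rcons (compile P o.+1) (IJump r o o o)
  end.

Lemma size_compile P o : size (compile P o) = csize P.
Proof.
elim: P o => //= [P IHP Q IHQ|r P IHP Q IHQ R IHR|r P IHP] o.
- by rewrite size_cat IHP IHQ.
- by rewrite size_cat /= size_cat /= IHP IHQ IHR; lia.
- by rewrite size_rcons IHP addn2.
Qed.

Definition iact (a : instr) (s : option (bool + void)) :
    option (bool + void) * move :=
  match a with
  | IUp _ => (s, MoveL)
  | ISet _ b => (Some (inl b), Stay)
  | IPop _ => (s, MoveR)
  | IJump _ _ _ _ => (s, Stay)
  end.

Definition inext (a : instr) (o : nat) (s : option (bool + void)) : nat :=
  match a, s with
  | IJump _ l _ _, None => l
  | IJump _ _ l _, Some (inl true) => l
  | IJump _ _ _ l, Some (inl false) => l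
  | _, _ => o.+1
  end.

(* The machine halts when the program counter leaves the code; the two extra
   states serve as rejecting and accepting exits. *)
Definition code_tm (T : nat) (code : seq instr) : tm :=
  @TM 'I_(size code).+2 void T ord0
    (fun q => size code <= q) (fun q => q == (size code).+1 :> nat)
    (fun q v => let a := nth (IPop 0) code q in
       (inord (inext a q (v (inord (ireg a)))),
        fun i : 'I_T.+1 => if i == ireg a :> nat then iact a (v i) else (v i, Stay))).

Definition store := nat -> seq bool.

Definition upd (s : store) (r : nat) (w : seq bool) : store :=
  fun i => if i == r then w else s i.

Definition bits (W : Type) (w : seq bool) : seq (option (bool + W)) :=
  [seq Some (inl b) | b <- w].

(** Compared cell by cell, since the tape may list explicit blanks below the stack. The left half is
    unconstrained. *)
Definition holds_stack (M : tm) (t : tape M) (w : seq bool) : Prop :=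
  forall p, nth None (cell t :: right t) p = nth None (bits (work M) w) p.

Definition holds_store (M : tm) (c : config M) (s : store) : Prop :=
  forall i : 'I_(tapes M).+1, holds_stack (ctape c i) (s i).

Definition subcode (code l : seq instr) (o : nat) : Prop :=
  exists A B, code = A ++ l ++ B /\ size A = o.

Lemma subcode_cat code l1 l2 o :
  subcode code (l1 ++ l2) o -> subcode code l1 o /\ subcode code l2 (o + size l1).
Proof.
case=> A [B [-> <-]]; split; first by exists A, (l2 ++ B); rewrite -!catA.
by exists (A ++ l1), B; rewrite size_cat -!catA.
Qed.

Lemma subcode_cons code a l o :
  subcode code (a :: l) o -> subcode code [:: a] o /\ subcode code l o.+1.
Proof. by rewrite -cat1s => /subcode_cat; rewrite addn1. Qed.

Lemma subcode_nth code a o :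
  subcode code [:: a] o -> o < size code /\ nth (IPop 0) code o = a.
Proof.
case=> A [B [-> <-]]; rewrite size_cat /= nth_cat ltnn subnn; split=> //; lia.
Qed.

Section Steps.
Variables (T : nat) (code : seq instr).
Hypothesis regs_le : all (fun a => ireg a <= T) code.
Let M := code_tm T code.

Definition at_pc (c : config M) (o : nat) (s : store) : Prop :=
  cstate c = o :> nat /\ holds_store c s.

Definition top (w : seq bool) : option (bool + void) := head None (bits void w).

Lemma step_code (c : config M) o a s :
  subcode code [:: a] o -> at_pc c o s -> inext a o (top (s (ireg a))) <= (size code).+1 ->
  exists2 c' : config M, step c = c' &
    cstate c' = inext a o (top (s (ireg a))) :> nat /\
    forall i : 'I_T.+1, ctape c' i =
      if i == ireg a :> nat then
        @shift M (iact a (cell (ctape c i))).2 (@write M (iact a (cell (ctape c i))).1 (ctape c i))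
      else ctape c i.
Proof.
move=> /subcode_nth[lt_o nth_o] [pc_o hs] le_next; eexists; first by [].
have le_a : ireg a <= T by rewrite -nth_o; exact: (elimT (all_nthP (IPop 0)) regs_le o lt_o).
have cell_a (i : 'I_T.+1) : cell (ctape c i) = top (s i).
  by have /= -> := hs i 0; rewrite /top; case: (s i).
have not_halted : halted c = false by rewrite /halted /= pc_o leqNgt lt_o.
rewrite /step not_halted /= pc_o nth_o; split=> /=.
  by rewrite ffunE cell_a !inordK.
move=> i; rewrite !ffunE; case: eqP => // _ /=.
by case: (ctape c i).
Qed.

Lemma holds_move (c c' : config M) s s' r :
  holds_store c s ->
  (forall i : 'I_T.+1, i <> r :> nat -> ctape c' i = ctape c i) ->
  (forall i : 'I_T.+1, i = r :> nat -> holds_stack (ctape c' i) (s' r)) ->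
  (forall i, i <> r -> s' i = s i) -> holds_store c' s'.
Proof.
move=> hs other this ss' i; case: (eqVneq (i : nat) r) => [ir|/eqP ir].
  by rewrite ir; apply: this.
by rewrite other // ss' //; apply: hs.
Qed.

Lemma at_pc_jump c o s r l0 l1 l2 (c' := step c) :
  subcode code [:: IJump r l0 l1 l2] o -> at_pc c o s ->
  inext (IJump r l0 l1 l2) o (top (s r)) <= (size code).+1 ->
  at_pc c' (inext (IJump r l0 l1 l2) o (top (s r))) s.
Proof.
move=> sub pc le; have [c1 e1 [pc1 tp]] := step_code sub pc le; rewrite /c' e1; split=> //.
apply: (holds_move pc.2 (r := r)) => // [i /eqP/negPf ir|i ir].
  by rewrite tp /= ir.
by rewrite tp /= ir eqxx /= => p; rewrite -ir -(pc.2 i); case: (ctape c i).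
Qed.

Lemma at_pc_pop c o s r (c' := step c) :
  subcode code [:: IPop r] o -> at_pc c o s ->
  at_pc c' o.+1 (upd s r (behead (s r))).
Proof.
move=> sub pc; have lt_o := (subcode_nth sub).1.
have [c1 e1 [pc1 tp]] := step_code sub pc (ltnW lt_o); rewrite /c' e1; split=> //.
apply: (holds_move pc.2 (r := r)) => [i /eqP/negPf ir|i ir|i /eqP/negPf ir].
- by rewrite tp /= ir.
- rewrite tp /= ir eqxx /upd /= eqxx => p.
  have := pc.2 i p.+1; rewrite ir /=.
  case: (s r) => [|b w] /=; last by move=> <-; case: (right _) => //; case: p => [|[]].
  move=> nil_p; transitivity (nth None (right (ctape c i)) p); last by rewrite nil_p nth_nil.
  by case: (right _) => //; case: p {nil_p} => [|[]].
- by rewrite /upd ir.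
Qed.

Lemma at_pc_push c o s r b (c' := step (step c)) :
  subcode code [:: IUp r; ISet r b] o -> at_pc c o s ->
  at_pc c' o.+2 (upd s r (b :: s r)).
Proof.
move=> /subcode_cons[sub1 sub2] pc; have lt_o := (subcode_nth sub1).1.
have [c1 e1 [pc1 tp1]] := step_code sub1 pc (ltnW lt_o).
have lt_o2 := (subcode_nth sub2).1.
rewrite /c' e1.
have not_halted : halted c1 = false by rewrite /halted /= pc1 leqNgt lt_o2.
have le_r : r <= T.
  have := elimT (all_nthP (IPop 0)) regs_le o.+1 lt_o2.
  by rewrite (subcode_nth sub2).2.
split; rewrite /step not_halted /= pc1 (subcode_nth sub2).2 /=.
  by rewrite inordK // ltnS ltnW // ltnS.
apply: (holds_move pc.2 (r := r)) => [i /eqP/negPf ir|i ir|i /eqP/negPf ir] /=.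
- by rewrite ir /= ffunE tp1 /= ir; case: (ctape c i).
- rewrite ir eqxx /= tp1 /= ir eqxx /= /upd eqxx => -[|p] //=.
  by rewrite -ir -(pc.2 i).
- by rewrite /upd ir.
Qed.

End Steps.

(** The code may sit anywhere in any machine with enough tapes, which makes the notion
    compositional. The time is exact because the machine goes on with whatever code follows; bounds
    enter with [runs_within]. *)
Definition runs (P : prog) (s : store) (t : nat) (s' : store) : Prop :=
  forall T code o (c : config (code_tm T code)),
    all (fun a => ireg a <= T) code -> subcode code (compile P o) o ->
    at_pc c o s -> at_pc (iter t (@step _) c) (o + csize P) s'.

Lemma at_pc_ext T code (c : config (code_tm T code)) o s s' :
  s =1 s' -> at_pc c o s -> at_pc c o s'.
Proof. by move=> ss' [pc hs]; split=> // i; rewrite -ss'; apply: hs. Qed.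

Lemma runs_ext P s t s' u u' :
  runs P s t s' -> s =1 u -> s' =1 u' -> runs P u t u'.
Proof.
move=> run su su' T code o c le sub pc.
by apply: at_pc_ext su' _; apply: run => //; apply: at_pc_ext pc => i; rewrite su.
Qed.

Lemma runs_push r b s : runs (Push r b) s 2 (upd s r (b :: s r)).
Proof. by move=> T code o c le sub pc; rewrite addn2; apply: at_pc_push. Qed.

Lemma runs_pop r s : runs (Pop r) s 1 (upd s r (behead (s r))).
Proof. by move=> T code o c le sub pc; rewrite addn1; apply: at_pc_pop. Qed.

Lemma runs_seq P Q s t1 s1 t2 s2 :
  runs P s t1 s1 -> runs Q s1 t2 s2 -> runs (Seq P Q) s (t1 + t2) s2.
Proof.
move=> runP runQ T code o c le /subcode_cat[subP].
rewrite size_compile => subQ pc; rewrite addnC iterD /= addnA.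
by apply: runQ => //; apply: runP.
Qed.

Lemma subcode_le code l o : subcode code l o -> o + size l <= size code.
Proof. by case=> A [B [-> <-]]; rewrite !size_cat addnA leq_addr. Qed.

Lemma subcode_first code a l o : subcode code (a :: l) o -> subcode code [:: a] o.
Proof. by case/subcode_cons. Qed.

Lemma runs_case r P Q R s t s' :
  runs (match s r with [::] => P | true :: _ => Q | false :: _ => R end) s t s' ->
  exists2 t', t' <= t + 2 & runs (Case r P Q R) s t' s'.
Proof.
move=> run.
(* One step for the initial test, and one for the jump that ends either of the first two
   branches. *)
exists ((if s r is false :: _ then 0 else 1) + (t + 1)).
  by case: (s r) => [|[] w]; lia.
move=> T code o c le; rewrite /csize -/csize => sub pc.
have le_end := subcode_le sub; move: sub le_end.
rewrite size_compile /=; set e := _ + csize R.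
have eE : e = o + (csize P + csize Q + csize R + 3) by rewrite /e; lia.
rewrite -eE.
move=> /subcode_cons[sub0] /subcode_cat[subP] /subcode_cons[].
rewrite size_compile => subj1 /subcode_cat[subQ] /subcode_cons[].
rewrite size_compile => subj2 subR le_end.
have next := at_pc_jump le sub0 pc.
have exit (c' : config (code_tm T code)) j : subcode code [:: IJump r e e e] j ->
    at_pc c' j s' -> at_pc (step c') e s'.
  move=> subj pcj; have := at_pc_jump le subj pcj.
  by rewrite /=; case: (top (s' r)) => [[[]|[]]|]; apply; lia.
rewrite !iterD /=.
case: (s r) run next => [|[] w] run /= next.
- by apply: exit subj1 _; apply: run => //; apply: next; lia.
- by apply: exit subj2 _; apply: run => //; apply: next; lia.
- by rewrite /e; apply: run => //; apply: next; lia.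
Qed.

Lemma runs_while_nil r P s : s r = [::] -> runs (While r P) s 1 s.
Proof.
move=> sr T code o c le sub pc /=.
have := subcode_le sub; rewrite size_compile /= => le_end.
have := at_pc_jump le (subcode_first sub) pc.
by rewrite sr /= -addnA; apply; lia.
Qed.

Lemma runs_while_cons r P s t1 s1 t2 s2 :
  s r != [::] -> runs P s t1 s1 -> runs (While r P) s1 t2 s2 ->
  runs (While r P) s (t1 + t2 + 2) s2.
Proof.
move=> sr runP runW T code o c le sub pc.
have := subcode_le sub; rewrite size_compile /= => le_end.
have [sub0 ] := subcode_cons sub; rewrite -cats1 => /subcode_cat[subP].
rewrite size_compile => subj.
have next : at_pc (step c) o.+1 s.
  have := at_pc_jump le sub0 pc.
  by case: (s r) sr => [|[] w] //= _; apply; lia.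
have {}next := runP _ _ _ _ le subP next.
have {}next := at_pc_jump le subj next.
have {}next : at_pc (step (iter t1 (@step _) (step c))) o s1.
  by move: next; case: (s1 r) => [|[] w] /=; apply; lia.
rewrite (_ : t1 + t2 + 2 = t2 + (1 + (t1 + 1))); last lia.
by rewrite !iterD /=; apply: runW.
Qed.

Definition runs_within (P : prog) (s : store) (B : nat) (s' : store) : Prop :=
  exists2 t, t <= B & runs P s t s'.

Lemma within_ext P s B s' u u' B' :
  runs_within P s B s' -> s =1 u -> s' =1 u' -> B <= B' -> runs_within P u B' u'.
Proof.
by case=> t tB run su su' BB'; exists t; [lia | apply: runs_ext run su su'].
Qed.

Lemma within_push r b s : runs_within (Push r b) s 2 (upd s r (b :: s r)).
Proof. by exists 2 => //; apply: runs_push. Qed.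

Lemma within_pop r s : runs_within (Pop r) s 1 (upd s r (behead (s r))).
Proof. by exists 1 => //; apply: runs_pop. Qed.

Lemma within_seq P Q s B1 s1 B2 s2 :
  runs_within P s B1 s1 -> runs_within Q s1 B2 s2 ->
  runs_within (Seq P Q) s (B1 + B2) s2.
Proof.
move=> [t1 le1 run1] [t2 le2 run2]; exists (t1 + t2); first lia.
exact: runs_seq run1 run2.
Qed.

Lemma within_case r P Q R s B s' :
  runs_within (match s r with [::] => P | true :: _ => Q | false :: _ => R end) s B s' ->
  runs_within (Case r P Q R) s (B + 2) s'.
Proof.
by case=> t le /runs_case[t' le' run]; exists t' => //; lia.
Qed.

(** Each round costs two jumps besides its body, and a final test leaves the loop. *)
Lemma within_while r P n B (st : nat -> store) :
  (forall i, i < n -> st i r != [::] /\ runs_within P (st i) B (st i.+1)) ->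
  st n r = [::] -> runs_within (While r P) (st 0) (n * (B + 2) + 1) (st n).
Proof.
elim: n st => [|n IHn] st body nil_r.
  by exists 1 => //; apply: runs_while_nil.
have [|t le run] := IHn (fun i => st i.+1) _ nil_r.
  by move=> i lt_i; apply: body.
have [sr [t1 le1 run1]] := body 0 isT.
exists (t1 + t + 2); first lia.
exact: runs_while_cons sr run1 run.
Qed.

(** * From stack programs to polynomial-time machines *)

Definition max_reg (code : seq instr) : nat := \max_(a <- code) ireg a.

Lemma max_regP T code : max_reg code <= T -> all (fun a => ireg a <= T) code.
Proof.
rewrite /max_reg; elim: code => //= a l IH.
by rewrite big_cons geq_max => /andP[-> /IH].
Qed.

Lemma nth_bits W (w : seq bool) p :
  nth None (bits W w) p = if p < size w then Some (inl (nth false w p)) else None.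
Proof.
case: ltnP => lt; first by rewrite (nth_map false).
by rewrite nth_default // size_map.
Qed.

Lemma leading_bitsP W (s : seq (option (bool + W))) (w : seq bool) :
  (forall p, nth None s p = nth None (bits W w) p) -> leading_bits s = w.
Proof.
elim: w s => [|b w IH] [|a s] eq_s //=.
- by have := eq_s 0 => /= ->.
- by have := eq_s 0.
- by have := eq_s 0 => /= ->; rewrite (IH s) // => p; have := eq_s p.+1.
Qed.

Lemma string_tapeP (M : tm) w : holds_stack (string_tape M w) w.
Proof. by case: w => [|b w] p //=; case: p => [|[]]. Qed.

Lemma holds_initial (M : tm) (ws : seq (seq bool)) : holds_store (initial M ws) (nth [::] ws).
Proof. by move=> i; apply: string_tapeP. Qed.

Lemma iter_halted (M : tm) (c : config M) t : halted c -> iter t (@step M) c = c.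
Proof. by move=> h; elim: t => //= t ->; rewrite /step h. Qed.

Lemma run_halted (M : tm) ws t t' :
  halted (run M ws t) -> t <= t' -> run M ws t' = run M ws t.
Proof. by move=> h /subnK <-; rewrite /run iterD iter_halted. Qed.

(** For positive [n] the base is at most [3 * n], and the constant term covers [n = 0]. Powers of a
    base above 1 absorb sums and products, so later bounds need a single exponent only. *)
Lemma poly_bound_expn d n : (n + 2) ^ d <= poly_bound (3 ^ d) d n.
Proof.
rewrite /poly_bound; case: d => [|d]; first by rewrite leq_addl.
case: n => [|n]; first by rewrite (leq_trans _ (leq_addl _ _)) // leq_exp2r.
by rewrite (leq_trans _ (leq_addr _ _)) // -expnMn leq_exp2r //; lia.
Qed.

Lemma prog_polytime_computable (f : seq bool -> seq bool) P d :
  (forall x, exists2 s', runs_within P (nth [::] [:: x]) ((size x + 2) ^ d) s'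
     & s' 0 = f x) ->
  polytime_computable f.
Proof.
move=> run; pose code := compile P 0; pose M := code_tm (max_reg code) code.
exists M, (3 ^ d), d => x /=.
have [s' [t le_t {}run] s'f] := run x.
have sub : subcode code code 0 by exists [::], [::]; rewrite cats0.
have pc0 : @at_pc _ _ (initial M [:: x]) 0 (nth [::] [:: x]).
  by split=> //; apply: holds_initial.
have [pc hs] := run _ _ _ _ (max_regP (leqnn _)) sub pc0.
have halt : halted (Defs.run M [:: x] t) by rewrite /halted /= pc size_compile.
rewrite (run_halted halt (leq_trans le_t (poly_bound_expn d _))); split=> //.
rewrite -s'f; apply: leading_bitsP => p; exact: hs.
Qed.

Lemma prog_NP (A : language) (V : seq bool -> seq bool -> Prop) P r d e f :
  (forall x y, exists2 s',
     runs_within P (nth [::] [:: x; y]) ((size x + size y + 2) ^ d) s'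
     & s' r != [::] <-> V x y) ->
  (forall x, A x <-> exists y, size y <= poly_bound e f (size x) /\ V x y) ->
  NP A.
Proof.
move=> run AV; pose n := csize P.
(* The final jump leads to the rejecting exit [n.+1] if register [r] is empty and to the accepting
   exit [n.+2] otherwise. Its one step is paid for by the exponent [d.+1]. *)
pose code := compile P 0 ++ [:: IJump r n.+1 n.+2 n.+2].
pose M := code_tm (max_reg code) code.
have size_code : size code = n.+1 by rewrite size_cat size_compile addn1.
exists M, (3 ^ d.+1), d.+1, e, f.
have final x y : exists t, let c := Defs.run M [:: x; y] t in
    [/\ t <= poly_bound (3 ^ d.+1) d.+1 (size x + size y), halted c
      & accepting (cstate c) <-> V x y].
  have [s' [t le_t {}run] s'V] := run x y.
  have [subP subj] : subcode code (compile P 0) 0 /\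
      subcode code [:: IJump r n.+1 n.+2 n.+2] (0 + size (compile P 0)).
    by apply: subcode_cat; exists [::], [::]; rewrite cats0.
  move: subj; rewrite size_compile add0n => subj.
  have pc0 : @at_pc _ _ (initial M [:: x; y]) 0 (nth [::] [:: x; y]).
    by split=> //; apply: holds_initial.
  have pc1 := run _ _ _ _ (max_regP (leqnn _)) subP pc0.
  have pc2 : @at_pc _ _ (Defs.run M [:: x; y] t.+1) (if s' r is [::] then n.+1 else n.+2) s'.
    have := at_pc_jump (max_regP (leqnn _)) subj pc1; rewrite size_code /top.
    by case: (s' r) => [|[] w] /=; apply.
  exists t.+1; split.
  - apply: leq_trans (poly_bound_expn _ _); rewrite expnS.
    by have := expn_gt0 (size x + size y + 2) d; nia.
  - by rewrite /halted /= pc2.1 size_code; case: (s' r).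
  - by rewrite -s'V /= pc2.1 size_code; case: (s' r) => [|b w]; rewrite ?eqxx ?ltn_eqF.
split=> [x y|x].
  by have [t [le_t halt _]] := final x y; rewrite (run_halted halt le_t).
rewrite AV; split=> -[y [le_y Vy]]; exists y; split=> //; move: Vy;
  by have [t [le_t halt <-]] := final x y; rewrite (run_halted halt le_t).
Qed.

(** * Polynomial-time functions on naturals in unary *)

Ltac upd_cases :=
  repeat match goal with
  | |- context [@eq_op _ ?a ?b] => case: (@eqP nat a b) => ?; try (exfalso; lia)
  end; subst.

Definition move_bit (r t : nat) : prog :=
  Case r (Pop r) (Seq (Push t true) (Pop r)) (Seq (Push t false) (Pop r)).

Lemma within_move_bit (r t : nat) s : r != t ->
  runs_within (move_bit r t) s 5
    (upd (upd s t (rev (take 1 (s r)) ++ s t)) r (behead (s r))).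
Proof.
move=> rt; rewrite /move_bit.
have mv b w : s r = b :: w -> runs_within (Seq (Push t b) (Pop r)) s 3
    (upd (upd s t (rev (take 1 (s r)) ++ s t)) r (behead (s r))).
  move=> sr; apply: within_ext (within_seq (within_push t b s) (within_pop r _)) _ _ _ => //.
  by move=> i; rewrite /upd (negPf rt) sr /= take0.
apply: within_ext (within_case (B := 3) (s' := _) _) (frefl s) (frefl _) _ => //.
case sr: (s r) => [|[] w]; try by rewrite -sr; apply: mv sr.
apply: within_ext (within_pop r s) (frefl s) _ _ => // i.
by rewrite /upd sr /=; case: eqP => // _; case: eqP => // ->.
Qed.

Definition move_bits (r t : nat) : prog := While r (move_bit r t).

Lemma within_move_bits (r t : nat) s : r != t ->
  runs_within (move_bits r t) s (size (s r) * 7 + 1)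
    (upd (upd s t (catrev (s r) (s t))) r [::]).
Proof.
move=> rt; pose st i := upd (upd s t (rev (take i (s r)) ++ s t)) r (drop i (s r)).
have := @within_while r (move_bit r t) (size (s r)) 5 st.
rewrite /move_bits => H; apply: within_ext (H _ _) _ _ _ => //.
- move=> i lt_i; split; first by rewrite /st /upd eqxx -size_eq0 size_drop -lt0n subn_gt0.
  apply: within_ext (within_move_bit _ rt) (frefl _) _ _ => // j.
  move/eqP: rt => rt; rewrite /st /upd; upd_cases => //.
    by rewrite -drop1 drop_drop add1n.
  by rewrite catA -rev_cat -[i.+1]addn1 takeD.
- by rewrite /st /upd eqxx drop_size.
- by move=> j; rewrite /st /upd take0 drop0; upd_cases.
- by move=> j; rewrite /st /upd take_size drop_size catrevE.
Qed.

Definition clear (r : nat) : prog := While r (Pop r).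

Lemma within_clear r s :
  runs_within (clear r) s (size (s r) * 3 + 1) (upd s r [::]).
Proof.
pose st i := upd s r (drop i (s r)).
have := @within_while r (Pop r) (size (s r)) 1 st.
move=> H; apply: within_ext (H _ _) _ _ _ => //.
- move=> i lt_i; split; first by rewrite /st /upd eqxx -size_eq0 size_drop -lt0n subn_gt0.
  apply: within_ext (within_pop _ _) (frefl _) _ _ => // j.
  by rewrite /st /upd eqxx; case: eqP => // _; rewrite -drop1 drop_drop add1n.
- by rewrite /st /upd eqxx drop_size.
- by move=> j; rewrite /st /upd drop0; case: eqP => [->|].
- by move=> j; rewrite /st /upd drop_size.
Qed.

(** The setting in which a function of the input is computed: two input strings, kept in registers 0
    and 1, and variables in unary. Loops and quantifiers bind a further variable through [ext], with
    the innermost variable first. *)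
Record ctx := Ctx {
  env :> Type;
  tape0 : env -> seq bool;
  tape1 : env -> seq bool;
  vars : seq (env -> nat)
}.

Definition ext (C : ctx) : ctx :=
  @Ctx (C * nat) (fun z => tape0 z.1) (fun z => tape1 z.1)
    (snd :: [seq (fun z => v z.1) | v <- vars C]).

Definition meas (C : ctx) (x : C) : nat :=
  size (tape0 x) + size (tape1 x) + sumn [seq v x | v <- vars C].

Lemma meas_ext (C : ctx) (z : ext C) : meas z = meas z.1 + z.2.
Proof.
by rewrite /meas /= -map_comp addnA addnAC -!addnA; congr (_ + (_ + _)); rewrite addnC.
Qed.

Definition pbounded (C : ctx) (f : C -> nat) : Prop :=
  exists d, forall x, f x <= (meas x + 2) ^ d.

Section Bounds.
Variable C : ctx.
Implicit Types f g : C -> nat.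

Lemma pbounded_le f g : pbounded g -> (forall x, f x <= g x) -> pbounded f.
Proof. by case=> d le_g le_f; exists d => x; apply: leq_trans (le_f x) (le_g x). Qed.

Lemma pbounded_const k : pbounded (fun _ : C => k).
Proof.
exists k => x; apply: (@leq_trans (2 ^ k)); first by rewrite ltnW // ltn_expl.
by case: k => // k; rewrite leq_exp2r // leq_addl.
Qed.

Lemma pbounded_meas : pbounded (@meas C).
Proof. by exists 1 => x; rewrite expn1 leq_addr. Qed.

Lemma pbounded_mul f g : pbounded f -> pbounded g -> pbounded (fun x => f x * g x).
Proof. by case=> d hf [e hg]; exists (d + e) => x; rewrite expnD leq_mul. Qed.

Lemma pbounded_add f g : pbounded f -> pbounded g -> pbounded (fun x => f x + g x).
Proof.
case=> d hf [e hg]; exists (d + e).+1 => x.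
have := hf x; have := hg x; set m := meas x + 2.
have d0 : 0 < m ^ d by rewrite expn_gt0 /m addn2.
have e0 : 0 < m ^ e by rewrite expn_gt0 /m addn2.
have m2 : 1 < m by rewrite /m addn2.
move=> le_g le_f; rewrite expnS expnD.
apply: leq_trans (leq_add le_f le_g) _; apply: (@leq_trans (2 * (m ^ d * m ^ e))).
  by nia.
by rewrite leq_mul2r m2 orbT.
Qed.

Lemma pbounded_exp f d : pbounded f -> pbounded (fun x => f x ^ d).
Proof.
move=> hf; elim: d => [|d IH]; first exact: pbounded_const.
apply: (pbounded_le (pbounded_mul hf IH)) => x; by rewrite expnS.
Qed.

(** Makes the cost of a loop body uniform in the loop index: an index up to [g x] raises the measure
    by at most [g x]. *)
Lemma pbounded_inst (f : ext C -> nat) g : pbounded f -> pbounded g ->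
  exists2 h, pbounded h & forall x i, i <= g x -> f (x, i) <= h x.
Proof.
case=> d hf hg; exists (fun x => (meas x + g x + 2) ^ d).
  apply: pbounded_exp; apply: pbounded_add (pbounded_const _).
  exact: pbounded_add pbounded_meas hg.
move=> x i le_i; apply: leq_trans (hf _) _; rewrite meas_ext /=.
by case: d {hf} => // d; rewrite leq_exp2r //; lia.
Qed.

End Bounds.

Definition located (C : ctx) (loc : seq nat) (b : nat) : Prop :=
  [/\ size loc = size (vars C), all (fun l => l < b) loc & 1 < b].

(** The empty registers from [b] on are work space. Registers below [b] that hold neither an input
    nor a variable are arbitrary, which leaves room for an output register. *)
Definition represents (C : ctx) (loc : seq nat) (b : nat) (x : C) (s : store) : Prop :=
  [/\ s 0 = tape0 x, s 1 = tape1 x,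
      forall i, i < size loc ->
        s (nth 0 loc i) = nseq (nth (fun=> 0) (vars C) i x) true
    & forall r, b <= r -> s r = [::]].

(* [F] is computed in polynomial time, in unary, into the first free register
   [b], whatever registers [loc] hold the variables. *)
Definition ptime (C : ctx) (F : C -> nat) : Prop :=
  pbounded F /\ forall loc b, located C loc b ->
  exists P (h : C -> nat), pbounded h /\ forall x s, represents loc b x s ->
    runs_within P s (h x) (upd s b (nseq (F x) true)).

Lemma ptime_ext (C : ctx) (F G : C -> nat) : F =1 G -> ptime F -> ptime G.
Proof.
move=> FG [bF pF]; split; first by apply: pbounded_le bF _ => x; rewrite FG.
move=> loc b lb; have [P [h [bh run]]] := pF _ _ lb; exists P, h; split=> // x s rep.
by rewrite -FG; apply: run.
Qed.

(* The bits of [r] are parked on [b.+1] while they are counted. *)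
Definition length_prog (r b : nat) : prog :=
  Seq (While r (Seq (move_bit r b.+1) (Push b true))) (move_bits b.+1 r).

Lemma within_length (r b : nat) s : r < b -> s b = [::] -> s b.+1 = [::] ->
  runs_within (length_prog r b) s (size (s r) * 16 + 2)
    (upd s b (nseq (size (s r)) true)).
Proof.
move=> rb sb sb1.
pose st i := upd (upd (upd s b.+1 (rev (take i (s r)))) r (drop i (s r))) b (nseq i true).
have rb1 : r != b.+1 by lia.
have H := @within_while r (Seq (move_bit r b.+1) (Push b true)) (size (s r)) 7 st.
apply: within_ext (within_seq (H _ _) (within_move_bits _ _)) _ _ _ => //.
- move=> i lt_i; split.
    by rewrite /st /upd; upd_cases; rewrite -size_eq0 size_drop -lt0n subn_gt0.
  apply: within_ext (within_seq (within_move_bit _ rb1) (within_push _ _ _)) (frefl _) _ _ => //.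
  move=> j; rewrite /st /upd; upd_cases => //.
    by rewrite -drop1 drop_drop add1n.
  by rewrite -rev_cat -[i.+1]addn1 takeD.
- by rewrite /st /upd; upd_cases; rewrite drop_size.
- by rewrite eq_sym.
- by move=> j; rewrite /st /upd take0 drop0; upd_cases.
- move=> j; rewrite /st /upd; upd_cases => //.
  by rewrite take_size drop_size catrevE revK cats0.
- by rewrite /st /upd; upd_cases; rewrite size_rev take_size; lia.
Qed.

Lemma pbounded_lift (C : ctx) (f : C -> nat) :
  pbounded f -> @pbounded (ext C) (fun z => f z.1).
Proof.
case=> d hf; exists d => z; apply: leq_trans (hf _) _; rewrite meas_ext.
by case: d {hf} => // d; rewrite leq_exp2r // leq_add2r leq_addr.
Qed.

Section Locations.
Variables (C : ctx) (loc : seq nat) (b : nat).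
Hypothesis lb : located C loc b.

Lemma located_le b' : b <= b' -> located C loc b'.
Proof.
case: lb => sz lt b1 le; split=> //; last by lia.
by apply: sub_all lt => i; lia.
Qed.

Lemma located_ext l b' : b <= b' -> l < b' -> located (ext C) (l :: loc) b'.
Proof.
move=> le ltl; have [sz lt b1] := located_le le.
by split=> //=; rewrite ?size_map ?sz ?ltl.
Qed.

Lemma represents_agree (x : C) s s' b' : represents loc b x s ->
  (forall r, r < b -> s' r = s r) -> (forall r, b' <= r -> s' r = [::]) ->
  represents loc b' x s'.
Proof.
case=> s0 s1 sv sb agree nil_s'; case: lb => sz lt b1; split=> //.
- by rewrite agree //; lia.
- by rewrite agree //; lia.
- move=> i lt_i; rewrite agree ?sv //; exact: (elimT (all_nthP 0) lt).
Qed.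

Lemma represents_ext (x : C) l i s b' :
  represents loc b' x s -> s l = nseq i true -> @represents (ext C) (l :: loc) b' (x, i) s.
Proof.
case=> s0 s1 sv sb sl; case: lb => sz lt b1; split=> // -[|j] //= lt_j.
by rewrite sv // (nth_map (fun=> 0)) // -sz.
Qed.

End Locations.

Section Closure.
Variable C : ctx.
Implicit Types F G : C -> nat.

Lemma ptime_const k : ptime (fun _ : C => k).
Proof.
split=> [|loc b lb]; first exact: pbounded_const.
(* [Pop b] on the empty register [b] serves as the empty program. *)
exists (iter k (fun P => Seq P (Push b true)) (Pop b)), (fun=> k * 2 + 1).
split=> [|x s [_ _ _ sb]]; first exact: pbounded_const.
elim: k => [|k IH] /=.
  apply: within_ext (within_pop b s) (frefl _) _ _ => // i.
  by rewrite /upd; upd_cases => //; rewrite !sb.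
apply: within_ext (within_seq IH (within_push _ _ _)) (frefl _) _ _; last lia.
by move=> i; rewrite /upd; upd_cases.
Qed.

Lemma ptime_var i : i < size (vars C) -> ptime (nth (fun=> 0) (vars C) i).
Proof.
move=> lt_i.
have bv : pbounded (nth (fun=> 0) (vars C) i).
  apply: pbounded_le (pbounded_meas C) _ => x; rewrite /meas.
  apply: leq_trans (leq_addl _ _).
  elim: (vars C) i lt_i => [|v l IH] [|i] //= lt_i; first exact: leq_addr.
  by apply: leq_trans (leq_addl _ _); apply: IH.
split=> // loc b [sz lt b1].
exists (length_prog (nth 0 loc i) b), (fun x => nth (fun=> 0) (vars C) i x * 16 + 2); split.
  by do !apply: pbounded_add; try apply: pbounded_mul => //; try exact: pbounded_const.
move=> x s [s0 s1 sv sb].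
have lt_l : nth 0 loc i < b by apply: (elimT (all_nthP 0) lt); rewrite sz.
have := within_length lt_l (sb _ (leqnn _)) (sb _ (leqnSn _)).
by rewrite sv ?sz // size_nseq.
Qed.

Lemma pbounded_tape0 : pbounded (fun x : C => size (tape0 x)).
Proof. by apply: pbounded_le (pbounded_meas C) _ => x; rewrite /meas; lia. Qed.

Lemma pbounded_tape1 : pbounded (fun x : C => size (tape1 x)).
Proof. by apply: pbounded_le (pbounded_meas C) _ => x; rewrite /meas; lia. Qed.

Lemma ptime_size0 : ptime (fun x : C => size (tape0 x)).
Proof.
split=> [|loc b [sz lt b1]]; first exact: pbounded_tape0.
exists (length_prog 0 b), (fun x => size (tape0 x) * 16 + 2); split.
  do !apply: pbounded_add; try apply: pbounded_mul; try exact: pbounded_const.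
  exact: pbounded_tape0.
move=> x s [s0 s1 sv sb].
by have := @within_length 0 b s (ltnW b1) (sb _ (leqnn _)) (sb _ (leqnSn _)); rewrite s0.
Qed.

Lemma ptime_op F G (op : nat -> nat -> nat) (Q : nat -> prog) k :
  (forall m n, op m n <= m + n) ->
  (forall b s m n, s b = nseq m true -> s b.+1 = nseq n true ->
     runs_within (Q b) s (k * (m + n) + k)
       (upd (upd s b.+1 [::]) b (nseq (op m n) true))) ->
  ptime F -> ptime G -> ptime (fun x => op (F x) (G x)).
Proof.
move=> op_le runQ [bF pF] [bG pG].
split; first by apply: pbounded_le (pbounded_add bF bG) _ => x.
move=> loc b lb; have [P [h [bh runP]]] := pF _ _ lb.
have lb1 := located_le lb (leqnSn b).
have [P' [h' [bh' runP']]] := pG _ _ lb1.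
exists (Seq P (Seq P' (Q b))), (fun x => h x + (h' x + (k * (F x + G x) + k))); split.
  by do !apply: pbounded_add => //; try apply: pbounded_mul; try exact: pbounded_const;
    apply: pbounded_add.
move=> x s rep; have [_ _ _ sb] := rep.
have rep1 : represents loc b.+1 x (upd s b (nseq (F x) true)).
  by apply: (represents_agree lb rep) => r le; rewrite /upd; upd_cases => //; rewrite sb //; lia.
have Hq := runQ b (upd (upd s b (nseq (F x) true)) b.+1 (nseq (G x) true)) (F x) (G x).
apply: within_ext (within_seq (runP _ _ rep) (within_seq (runP' _ _ rep1) (Hq _ _))) (frefl _) _ _ => //.
- by rewrite /upd; upd_cases.
- by rewrite /upd; upd_cases.
- by move=> r; rewrite /upd; upd_cases => //; rewrite sb.
Qed.

Lemma within_count r P s n B (st : nat -> store) :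
  s =1 st 0 -> (forall i, i <= n -> st i r = nseq (n - i) true) ->
  (forall i, i < n -> runs_within P (st i) B (st i.+1)) ->
  runs_within (While r P) s (n * (B + 2) + 1) (st n).
Proof.
move=> s0 cnt body.
apply: within_ext (within_while (r := r) (st := st) (n := n) _ _) _ _ _ => //.
- move=> i lt_i; split; last by apply: body.
  by rewrite cnt ?(ltnW lt_i) // -size_eq0 size_nseq -lt0n subn_gt0.
- by rewrite cnt // subnn.
Qed.

Lemma behead_nseq T n (a : T) : behead (nseq n a) = nseq n.-1 a.
Proof. by case: n. Qed.

Lemma ptime_add F G : ptime F -> ptime G -> ptime (fun x => F x + G x).
Proof.
apply: (@ptime_op F G addn (fun b => While b.+1 (Seq (Push b true) (Pop b.+1))) 5) => //.
move=> b s m n sb sb1.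
pose st i := upd (upd s b.+1 (nseq (n - i) true)) b (nseq (m + i) true).
apply: within_ext (within_count (r := b.+1) (st := st) (n := n) (B := 3) _ _ _) (frefl _) _ _.
- by move=> i; rewrite /st /upd subn0 addn0; upd_cases.
- by move=> i _; rewrite /st /upd; upd_cases.
- move=> i lt_i; apply: within_ext (within_seq (within_push _ _ _) (within_pop _ _)) (frefl _) _ _ => //.
  by move=> j; rewrite /st /upd; upd_cases => //; rewrite ?addnS // behead_nseq subnS.
- by move=> j; rewrite /st /upd subnn.
- lia.
Qed.

Lemma ptime_sub F G : ptime F -> ptime G -> ptime (fun x => F x - G x).
Proof.
apply: (@ptime_op F G subn (fun b => While b.+1 (Seq (Pop b) (Pop b.+1))) 4) => [m n|].
  by lia.
move=> b s m n sb sb1.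
pose st i := upd (upd s b.+1 (nseq (n - i) true)) b (nseq (m - i) true).
apply: within_ext (within_count (r := b.+1) (st := st) (n := n) (B := 2) _ _ _) (frefl _) _ _.
- by move=> i; rewrite /st /upd !subn0; upd_cases.
- by move=> i _; rewrite /st /upd; upd_cases.
- move=> i lt_i; apply: within_ext (within_seq (within_pop _ _) (within_pop _ _)) (frefl _) _ _ => //.
  by move=> j; rewrite /st /upd; upd_cases => //; rewrite behead_nseq subnS.
- by move=> j; rewrite /st /upd subnn.
- lia.
Qed.

Lemma catrev_nseq n : catrev (nseq n true) [::] = nseq n true.
Proof. by rewrite catrevE cats0 rev_nseq. Qed.

Lemma pbounded_sup2 (f : ext (ext C) -> nat) G H : pbounded f -> pbounded G -> pbounded H ->
  exists2 h, pbounded h &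
    forall x i a, i <= G x -> a <= H x -> f ((x, i), a) <= h x.
Proof.
move=> bf bG bH; have [h1 bh1 le1] := pbounded_inst bf (pbounded_lift bH).
have [h bh le] := pbounded_inst bh1 bG; exists h => // x i a le_i le_a.
exact: leq_trans (le1 (x, i) a le_a) (le x i le_i).
Qed.

(** Bounded primitive recursion. The polynomial bound [B] on all intermediate values excludes, for
    instance, repeated doubling, whose values would be exponentially long in unary. *)
Lemma ptime_iter (N F0 B : C -> nat) (F : ext (ext C) -> nat)
    (acc := fun x i => iteri i (fun j a => F ((x, j), a)) (F0 x)) :
  pbounded B -> (forall x i, i <= N x -> acc x i <= B x) ->
  ptime N -> ptime F0 -> ptime F -> ptime (fun x => acc x (N x)).
Proof.
move=> bB le_B [bN pN] [b0 p0] [bF pF].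
split; first by apply: pbounded_le bB _ => x; apply: le_B.
move=> loc b lb; have [P0 [h0 [bh0 run0]]] := p0 _ _ lb.
have lb1 := located_le lb (leqnSn b).
have [PN [hN [bhN runN]]] := pN _ _ lb1.
have [le3 lt0 lt2] : [/\ b <= b.+3, b < b.+3 & b.+2 < b.+3] by split; lia.
have lb3 : located (ext (ext C)) [:: b, b.+2 & loc] b.+3.
  exact: (located_ext (located_ext lb le3 lt2) (leqnn _) lt0).
have [P [h [bh run]]] := pF _ _ lb3.
have [h' bh' le_h'] := pbounded_sup2 bh bN bB.
(* Register [b] holds the accumulator, [b.+1] the number of rounds left, [b.+2] the loop index, and
   [b.+3] receives the new value. Moving reverses a stack, which does not matter in unary. *)
pose body := Seq P (Seq (clear b) (Seq (move_bits b.+3 b) (Seq (Push b.+2 true) (Pop b.+1)))).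
pose t x := h' x + (B x * 10 + 5).
exists (Seq P0 (Seq PN (Seq (While b.+1 body) (clear b.+2)))),
  (fun x => h0 x + (hN x + (N x * (t x + 2) + 1 + (N x * 3 + 1)))); split.
  by do ![apply: pbounded_add => //|apply: pbounded_mul => //|exact: pbounded_const].
move=> x s rep; have [_ _ _ sb] := rep.
pose st i := upd (upd (upd s b (nseq (acc x i) true)) b.+1 (nseq (N x - i) true))
  b.+2 (nseq i true).
have rep1 : represents loc b.+1 x (upd s b (nseq (F0 x) true)).
  by apply: (represents_agree lb rep) => r le; rewrite /upd; upd_cases => //; rewrite sb //; lia.
have W := within_count (r := b.+1) (P := body) (st := st) (n := N x) (B := t x) _ _ _.
apply: within_ext (within_seq (run0 _ _ rep) (within_seq (runN _ _ rep1)
  (within_seq (W _ _ _ _) (within_clear _ _)))) (frefl _) _ _ => //.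
- move=> r; rewrite /st /upd subn0 /=; upd_cases => //; by rewrite sb.
- by move=> i _; rewrite /st /upd; upd_cases.
- move=> i lt_i; have rep3 : @represents (ext (ext C)) [:: b, b.+2 & loc] b.+3 ((x, i), acc x i) (st i).
    apply: (represents_ext (located_ext lb le3 lt2)); last by rewrite /st /upd; upd_cases.
    apply: (represents_ext lb); last by rewrite /st /upd; upd_cases.
    apply: (represents_agree lb rep) => r le; rewrite /st /upd; upd_cases => //.
    by rewrite sb //; lia.
  apply: within_ext (within_seq (run _ _ rep3) (within_seq (within_clear _ _)
    (within_seq (within_move_bits _ _) (within_seq (within_push _ _ _) (within_pop _ _)))))
    (frefl _) _ _ => //; first by lia.
  + by move=> r; rewrite /st /upd; upd_cases => //;
      rewrite ?behead_nseq ?subnS ?catrev_nseq ?sb.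
  + have := le_h' x i (acc x i) (ltnW lt_i) (le_B x i (ltnW lt_i)).
    have := le_B x i (ltnW lt_i); have := le_B x i.+1 lt_i.
    rewrite /st /t /upd; upd_cases; rewrite !size_nseq -/(acc x i.+1) /=; lia.
- by move=> r; rewrite /st /upd subnn; upd_cases => //; rewrite sb.
- by rewrite /st /upd; upd_cases; rewrite size_nseq.
Qed.

End Closure.

(** The bits before the wanted one are parked on [b.+1] and put back afterwards. Past the end of the
    string the test finds an empty stack, in accordance with the default [false]. *)
Definition lookup (r b : nat) : prog :=
  Seq (While b (Seq (move_bit r b.+1) (Pop b)))
    (Seq (Case r (Pop b) (Push b true) (Pop b)) (move_bits b.+1 r)).

Lemma within_lookup (r b k : nat) s :
  r < b -> s b = nseq k true -> s b.+1 = [::] ->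
  runs_within (lookup r b) s (k * 8 + size (s r) * 7 + 6)
    (upd s b (nseq (nth false (s r) k) true)).
Proof.
move=> rb sb sb1; set w := s r.
pose st i := upd (upd (upd s b.+1 (rev (take i w))) r (drop i w)) b (nseq (k - i) true).
have rb1 : r != b.+1 by lia.
have br1 : b.+1 != r by lia.
have W := within_count (r := b) (P := Seq (move_bit r b.+1) (Pop b)) (st := st)
  (s := s) (n := k) (B := 6) _ _ _.
have C : runs_within (Case r (Pop b) (Push b true) (Pop b)) (st k) 4
    (upd (st k) b (nseq (nth false w k) true)).
  apply: within_ext (within_case (B := 2) _) (frefl _) (frefl _) _ => //.
  have -> : st k r = drop k w by rewrite /st /upd; upd_cases.
  have eq_b : st k b = [::] by rewrite /st /upd subnn; upd_cases.
  rewrite -[k in nth _ _ k]addn0 -nth_drop.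
  case: (drop k w) => [|[] l] /=.
  - by apply: within_ext (within_pop _ _) (frefl _) _ _ => // j; rewrite /upd eq_b.
  - by apply: within_ext (within_push _ _ _) (frefl _) _ _ => // j; rewrite eq_b.
  - by apply: within_ext (within_pop _ _) (frefl _) _ _ => // j; rewrite /upd eq_b.
apply: within_ext (within_seq (W _ _ _) (within_seq C (within_move_bits _ br1))) (frefl _) _ _.
- by move=> j; rewrite /st /upd take0 drop0 subn0; upd_cases.
- by move=> i _; rewrite /st /upd; upd_cases.
- move=> i lt_i; apply: within_ext (within_seq (within_move_bit _ rb1) (within_pop _ _)) (frefl _) _ _ => //.
  move=> j; rewrite /st /upd; upd_cases; rewrite ?behead_nseq ?subnS //.
    by rewrite -drop1 drop_drop add1n.
  by rewrite -rev_cat -[i.+1]addn1 takeD.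
- move=> j; rewrite /st /upd; upd_cases => //.
  by rewrite catrevE revK cat_take_drop.
- rewrite /st /upd; upd_cases; rewrite size_rev size_take_min; lia.
Qed.

Section Closure.
Variable C : ctx.
Implicit Types F G : C -> nat.

Lemma ptime_lookup (tp : C -> seq bool) (r : nat) F :
  (forall loc b x s, located C loc b -> represents loc b x s -> r < b /\ s r = tp x) ->
  pbounded (fun x => size (tp x)) ->
  ptime F -> ptime (fun x => nth false (tp x) (F x) : nat).
Proof.
move=> tape_r b_tp [bF pF]; split.
  by apply: pbounded_le (pbounded_const C 1) _ => x; case: nth.
move=> loc b lb; have [P [h [bh run]]] := pF _ _ lb.
exists (Seq P (lookup r b)), (fun x => h x + (F x * 8 + size (tp x) * 7 + 6)); split.
  by do ![apply: pbounded_add => //|apply: pbounded_mul => //|exact: pbounded_const].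
move=> x s rep; have [rb sr] := tape_r _ _ _ _ lb rep; have [_ _ _ sb] := rep.
have L := within_lookup (k := F x) (s := upd s b (nseq (F x) true)) rb _ _.
apply: within_ext (within_seq (run _ _ rep) (L _ _)) (frefl _) _ _.
- by rewrite /upd eqxx.
- by rewrite /upd; upd_cases; rewrite sb.
- by move=> j; rewrite /upd; upd_cases => //; rewrite sr.
- by rewrite /upd; upd_cases; rewrite sr.
Qed.

Lemma ptime_nth0 F : ptime F -> ptime (fun x => nth false (tape0 x) (F x) : nat).
Proof.
apply: (@ptime_lookup _ 0); last exact: pbounded_tape0.
by move=> loc b x s [_ _ b1] [s0 _ _ _]; split=> //; lia.
Qed.

Lemma ptime_nth1 F : ptime F -> ptime (fun x => nth false (tape1 x) (F x) : nat).
Proof.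
apply: (@ptime_lookup _ 1); last exact: pbounded_tape1.
by move=> loc b x s [_ _ b1] [_ s1 _ _]; split.
Qed.

Lemma ptime_lift F : ptime F -> @ptime (ext C) (fun z => F z.1).
Proof.
case=> bF pF; split=> [|[|l loc] b [] //= [sz] /andP[ltl lt] b1].
  exact: pbounded_lift.
have lb : located C loc b by split; rewrite // -(size_map (fun v (z : ext C) => v z.1)).
have [P [h [bh run]]] := pF _ _ lb; exists P, (fun z => h z.1); split.
  exact: pbounded_lift.
move=> [x i] s [/= s0 s1 sv sb]; apply: run; split=> // j lt_j.
have := sv j.+1 lt_j; rewrite /= => ->; rewrite (nth_map (fun=> 0)) //.
by case: lb => <-.
Qed.

Lemma ptime_newest : @ptime (ext C) snd.
Proof. exact: (@ptime_var (ext C) 0). Qed.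

End Closure.

(** * Arithmetic, comparisons and Boolean connectives *)

Section Derived.
Variable C : ctx.
Implicit Types F G : C -> nat.
Implicit Types P Q : C -> bool.

Lemma pbounded_value F : ptime F -> pbounded F.
Proof. by case. Qed.

Lemma ptime_mul F G : ptime F -> ptime G -> ptime (fun x => F x * G x).
Proof.
move=> pF pG.
have accE x i : iteri i (fun _ a => a + G x) 0 = i * G x.
  by elim: i => //= i ->; rewrite mulSn addnC.
apply: ptime_ext (fun x => accE x (F x)) _.
apply: (ptime_iter (F := fun z => z.2 + G z.1.1) (F0 := fun=> 0) (B := fun x => F x * G x)) => //.
- by apply: pbounded_mul; apply: pbounded_value.
- by move=> x i le; rewrite accE leq_mul2r le orbT.
- exact: ptime_const.
- exact: (ptime_add (ptime_newest _) (ptime_lift (ptime_lift pG))).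
Qed.

Lemma ptime_exp F d : ptime F -> ptime (fun x => F x ^ d).
Proof.
move=> pF; elim: d => [|d IH]; first exact: ptime_const.
by apply: ptime_ext (ptime_mul pF IH) => x; rewrite expnS.
Qed.

Definition pdecidable P : Prop := ptime (fun x => P x : nat).

Lemma pdecidable_ext P Q : P =1 Q -> pdecidable P -> pdecidable Q.
Proof. by move=> PQ; apply: ptime_ext => x; rewrite PQ. Qed.

Lemma pdecidable_not P : pdecidable P -> pdecidable (fun x => ~~ P x).
Proof.
move=> pP; apply: ptime_ext (ptime_sub (ptime_const C 1) pP) => x.
by case: (P x).
Qed.

Lemma pdecidable_and P Q : pdecidable P -> pdecidable Q -> pdecidable (fun x => P x && Q x).
Proof. by move=> pP pQ; apply: ptime_ext (ptime_mul pP pQ) => x; rewrite mulnb. Qed.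

Lemma pdecidable_or P Q : pdecidable P -> pdecidable Q -> pdecidable (fun x => P x || Q x).
Proof.
move=> pP pQ.
apply: pdecidable_ext (pdecidable_not (pdecidable_and (pdecidable_not pP) (pdecidable_not pQ))).
by move=> x; rewrite negb_and !negbK.
Qed.

Lemma pdecidable_imply P Q : pdecidable P -> pdecidable Q -> pdecidable (fun x => P x ==> Q x).
Proof.
move=> pP pQ; apply: pdecidable_ext (pdecidable_or (pdecidable_not pP) pQ) => x.
by rewrite implybE.
Qed.

Lemma pdecidable_const (b : bool) : pdecidable (fun _ => b).
Proof. exact: ptime_const. Qed.

Lemma pdecidable_leq F G : ptime F -> ptime G -> pdecidable (fun x => F x <= G x).
Proof.
move=> pF pG.
apply: ptime_ext (ptime_sub (ptime_const C 1) (ptime_sub pF pG)) => x.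
by rewrite /leq; case: (F x - G x).
Qed.

Lemma pdecidable_ltn F G : ptime F -> ptime G -> pdecidable (fun x => F x < G x).
Proof.
move=> pF pG; apply: pdecidable_leq => //.
by apply: ptime_ext (ptime_add (ptime_const C 1) pF) => x.
Qed.

Lemma pdecidable_eqn F G : ptime F -> ptime G -> pdecidable (fun x => F x == G x).
Proof.
move=> pF pG; apply: pdecidable_ext (pdecidable_and (pdecidable_leq pF pG) (pdecidable_leq pG pF)).
by move=> x; rewrite eqn_leq.
Qed.

Lemma pdecidable_eqb P Q : pdecidable P -> pdecidable Q -> pdecidable (fun x => P x == Q x).
Proof.
move=> pP pQ; apply: pdecidable_ext (pdecidable_eqn pP pQ) => x.
by case: (P x); case: (Q x).
Qed.

Lemma ptime_succ F : ptime F -> ptime (fun x => (F x).+1).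
Proof. by move=> pF; apply: ptime_ext (ptime_add (ptime_const C 1) pF). Qed.

Lemma ptime_pred F : ptime F -> ptime (fun x => (F x).-1).
Proof. by move=> pF; apply: ptime_ext (ptime_sub pF (ptime_const C 1)) => x; rewrite subn1. Qed.

Lemma ptime_if P F G : pdecidable P -> ptime F -> ptime G ->
  ptime (fun x => if P x then F x else G x).
Proof.
move=> pP pF pG.
apply: ptime_ext (ptime_add (ptime_mul pP pF) (ptime_mul (pdecidable_not pP) pG)) => x.
by case: (P x); rewrite /= ?mul1n ?mul0n ?addn0.
Qed.

Lemma pdecidable_if P Q R : pdecidable P -> pdecidable Q -> pdecidable R ->
  pdecidable (fun x => if P x then Q x else R x).
Proof.
move=> pP pQ pR; apply: ptime_ext (ptime_if pP pQ pR) => x.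
by case: (P x).
Qed.

Lemma ptime_minn F G : ptime F -> ptime G -> ptime (fun x => minn (F x) (G x)).
Proof. by move=> pF pG; apply: ptime_if => //; apply: pdecidable_ltn. Qed.

Lemma pdecidable_nth0 F : ptime F -> pdecidable (fun x => nth false (tape0 x) (F x)).
Proof. exact: ptime_nth0. Qed.

Lemma pdecidable_nth1 F : ptime F -> pdecidable (fun x => nth false (tape1 x) (F x)).
Proof. exact: ptime_nth1. Qed.

End Derived.

(** * Bounded quantifiers, counting and division *)

Section Bounded.
Variable C : ctx.
Implicit Types N F G : C -> nat.

Lemma iota0_rcons n : iota 0 n.+1 = rcons (iota 0 n) n.
Proof. by rewrite -addn1 iotaD cats1. Qed.

Lemma pdecidable_has_iota N (P : ext C -> bool) : ptime N -> pdecidable P ->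
  pdecidable (fun x => has (fun i => P (x, i)) (iota 0 (N x))).
Proof.
move=> pN pP.
have accE x i : iteri i (fun j a => (0 < a) || P (x, j) : nat) 0
    = has (fun j => P (x, j)) (iota 0 i).
  elim: i => // i IH; rewrite [LHS]/= IH iota0_rcons has_rcons orbC.
  by case: has.
apply: ptime_ext (fun x => accE x (N x)) _.
apply: (ptime_iter (F := fun z => (0 < z.2) || P z.1) (F0 := fun=> 0) (B := fun x => 1)) => //.
- exact: pbounded_const.
- by move=> x i _; rewrite accE; case: has.
- exact: ptime_const.
- exact: (pdecidable_or (pdecidable_ltn (ptime_const _ 0) (ptime_newest _)) (ptime_lift pP)).
Qed.

Lemma pdecidable_all_iota N (P : ext C -> bool) : ptime N -> pdecidable P ->
  pdecidable (fun x => all (fun i => P (x, i)) (iota 0 (N x))).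
Proof.
move=> pN pP; apply: pdecidable_ext (pdecidable_not (pdecidable_has_iota pN (pdecidable_not pP))).
by move=> x; rewrite -all_predC; apply: eq_all => i /=; rewrite negbK.
Qed.

Lemma pdecidable_has_seq (T : eqType) (s : seq T) (P : T -> C -> bool) :
  (forall a, a \in s -> pdecidable (P a)) -> pdecidable (fun x => has (fun a => P a x) s).
Proof.
elim: s => [|a s IH] pP; first exact: pdecidable_const.
apply: pdecidable_or; first by apply: pP; rewrite mem_head.
by apply: IH => c c_s; apply: pP; rewrite inE c_s orbT.
Qed.

Lemma ptime_count_iota N (P : ext C -> bool) : ptime N -> pdecidable P ->
  ptime (fun x => count (fun i => P (x, i)) (iota 0 (N x))).
Proof.
move=> pN pP.
have accE x i : iteri i (fun j a => a + P (x, j)) 0 = count (fun j => P (x, j)) (iota 0 i).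
  by elim: i => // i IH; rewrite [LHS]/= IH iota0_rcons -cats1 count_cat /= addn0.
apply: ptime_ext (fun x => accE x (N x)) _.
apply: (ptime_iter (F := fun z => z.2 + P z.1) (F0 := fun=> 0) (B := N)) => //.
- by apply: pbounded_value.
- by move=> x i le; rewrite accE (leq_trans (count_size _ _)) // size_iota.
- exact: ptime_const.
- exact: (ptime_add (ptime_newest _) (ptime_lift pP)).
Qed.

Lemma count_ltn_iota u m : u <= m -> count (fun q => q < u) (iota 0 m) = u.
Proof.
move=> le_u; have -> : iota 0 m = iota 0 u ++ iota u (m - u).
  by rewrite -{2}[u]add0n -iotaD subnKC.
rewrite count_cat (eq_in_count (a2 := predT)); last by move=> q; rewrite mem_iota.
rewrite count_predT size_iota (eq_in_count (a2 := pred0)) ?count_pred0 ?addn0 //.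
by move=> q; rewrite mem_iota leqNgt => /andP[/negPf].
Qed.

Lemma ptime_divn F G : ptime F -> ptime G -> ptime (fun x => F x %/ G x).
Proof.
move=> pF pG.
(* The quotient counts the positive multiples of [d] up to [m]. For [d = 0] the count would be [m],
   while the quotient is 0 by convention. *)
have divE m d : (if d == 0 then 0 else count (fun q => q.+1 * d <= m) (iota 0 m)) = m %/ d.
  case: posnP => [->|d0]; first by rewrite divn0.
  rewrite (eq_count (a2 := fun q => q < m %/ d)); last by move=> q; rewrite leq_divRL.
  by rewrite count_ltn_iota // leq_div.
apply: ptime_ext (fun x => divE (F x) (G x)) _.
apply: ptime_if; [|exact: ptime_const|].
  exact: (pdecidable_eqn pG (ptime_const _ 0)).
apply: (ptime_count_iota (P := fun z => z.2.+1 * G z.1 <= F z.1)) => //.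
apply: pdecidable_leq; last exact: ptime_lift.
exact: (ptime_mul (ptime_succ (ptime_newest _)) (ptime_lift pG)).
Qed.

Lemma ptime_modn F G : ptime F -> ptime G -> ptime (fun x => F x %% G x).
Proof.
move=> pF pG; apply: ptime_ext (ptime_sub pF (ptime_mul (ptime_divn pF pG) pG)) => x.
by rewrite {1}(divn_eq (F x) (G x)) addKn.
Qed.

Lemma pdecidable_odd F : ptime F -> pdecidable (fun x => odd (F x)).
Proof.
move=> pF; apply: ptime_ext (ptime_modn pF (ptime_const _ 2)) => x.
by rewrite modn2.
Qed.

End Bounded.

(** By repeated halving: the power of two itself need not be polynomially bounded, but the quotients
    never exceed [F x]. *)
Lemma ptime_div_expn2 (C : ctx) (F G : C -> nat) : ptime F -> ptime G -> ptime (fun x => F x %/ 2 ^ G x).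
Proof.
move=> pF pG.
have accE x i : iteri i (fun _ a => a %/ 2) (F x) = F x %/ 2 ^ i.
  by elim: i => [|i /= ->]; rewrite ?divn1 // -divnMA expnSr.
apply: ptime_ext (fun x => accE x (G x)) _.
apply: (ptime_iter (F := fun z => z.2 %/ 2) (F0 := F) (B := F)) => //.
- by apply: pbounded_value.
- by move=> x i le; rewrite accE leq_div.
- exact: (ptime_divn (ptime_newest _) (ptime_const _ 2)).
Qed.

(** * Emitting an output string *)

(* Register 2 accumulates the output in reverse order. *)
Definition emits (C : ctx) (G : C -> seq bool) : Prop :=
  pbounded (fun x => size (G x)) /\
  forall loc b, located C loc b -> 2 < b -> 2 \notin loc ->
  exists P (h : C -> nat), pbounded h /\ forall x s, represents loc b x s ->
    runs_within P s (h x) (upd s 2 (catrev (G x) (s 2))).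

Lemma represents_out (C : ctx) loc b (x : C) s w :
  2 < b -> 2 \notin loc -> represents loc b x s -> represents loc b x (upd s 2 w).
Proof.
move=> b2 loc2 [s0 s1 sv sb]; split=> //.
- move=> i lt_i; rewrite /upd; case: eqP => [e|_]; last exact: sv.
  by case/negP: loc2; rewrite -e mem_nth.
- by move=> r le; rewrite /upd; upd_cases; apply: sb.
Qed.

Section Emit.
Variable C : ctx.

Lemma emits_ext (G G' : C -> seq bool) : G =1 G' -> emits G -> emits G'.
Proof.
move=> GG' [bG eG]; split; first by apply: pbounded_le bG _ => x; rewrite GG'.
move=> loc b lb b2 loc2; have [P [h [bh run]]] := eG _ _ lb b2 loc2.
by exists P, h; split=> // x s rep; rewrite -GG'; apply: run.
Qed.

Lemma emits_cat (G G' : C -> seq bool) : emits G -> emits G' -> emits (fun x => G x ++ G' x).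
Proof.
case=> bG eG [bG' eG']; split.
  by apply: pbounded_le (pbounded_add bG bG') _ => x; rewrite size_cat.
move=> loc b lb b2 loc2; have [P [h [bh run]]] := eG _ _ lb b2 loc2.
have [P' [h' [bh' run']]] := eG' _ _ lb b2 loc2.
exists (Seq P P'), (fun x => h x + h' x); split; first exact: pbounded_add.
move=> x s rep; have rep' := represents_out (catrev (G x) (s 2)) b2 loc2 rep.
apply: within_ext (within_seq (run _ _ rep) (run' _ _ rep')) (frefl _) _ _ => // j.
by rewrite /upd; upd_cases => //; rewrite !catrevE rev_cat catA.
Qed.

Lemma emits_bit (P : C -> bool) : pdecidable P -> emits (fun x => [:: P x]).
Proof.
case=> bP pP; split; first exact: pbounded_const.
move=> loc b lb b2 loc2; have [Q [h [bh run]]] := pP _ _ lb.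
exists (Seq Q (Case b (Push 2 false) (Seq (Push 2 true) (Pop b)) (Pop b))), (fun x => h x + 5).
split; first by apply: pbounded_add => //; apply: pbounded_const.
move=> x s rep; have [_ _ _ sb] := rep.
pose s1 := upd s b (nseq (P x) true).
have H : runs_within (Case b (Push 2 false) (Seq (Push 2 true) (Pop b)) (Pop b)) s1 5
    (upd s 2 (P x :: s 2)).
  apply: within_ext (within_case (B := 3) _) (frefl _) (frefl _) _ => //.
  have -> : s1 b = nseq (P x) true by rewrite /s1 /upd eqxx.
  rewrite /s1; case: (P x) => /=.
    apply: within_ext (within_seq (within_push _ _ _) (within_pop _ _)) (frefl _) _ _ => // j.
    by rewrite /upd; upd_cases => //; rewrite ?sb.
  apply: within_ext (within_push _ _ _) (frefl _) _ _ => // j.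
  by rewrite /upd; upd_cases => //; rewrite ?sb.
by apply: within_ext (within_seq (run _ _ rep) H) (frefl _) _ _.
Qed.

Lemma emits_iota (N : C -> nat) (G : ext C -> seq bool) : ptime N -> emits G ->
  emits (fun x => flatten [seq G (x, i) | i <- iota 0 (N x)]).
Proof.
case=> bN pN [bG eG].
have [g bg le_g] := pbounded_inst bG bN.
split.
  apply: pbounded_le (pbounded_mul bN bg) _ => x; rewrite size_flatten /shape -map_comp.
  have : all (fun i => i <= N x) (iota 0 (N x)).
    by apply/allP => i; rewrite mem_iota; lia.
  rewrite -[in X in _ <= X](size_iota 0 (N x)); elim: (iota _ _) => //= i l IH /andP[le_i /IH].
  by rewrite mulSn => le; apply: leq_add (le_g x i le_i) le.
move=> loc b lb b2 loc2; have [PN [hN [bhN runN]]] := pN _ _ lb.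
have [le2 lt1] : b <= b.+2 /\ b.+1 < b.+2 by split; lia.
have lb2 := located_ext lb le2 lt1.
have [||P [h [bh run]]] := eG _ _ lb2; [lia | by rewrite inE negb_or loc2 andbT; lia |].
have [h' bh' le_h'] := pbounded_inst bh bN.
pose body := Seq P (Seq (Push b.+1 true) (Pop b)).
exists (Seq PN (Seq (While b body) (clear b.+1))),
  (fun x => hN x + (N x * (h' x + 3 + 2) + 1 + (N x * 3 + 1))); split.
  by do ![apply: pbounded_add => //|apply: pbounded_mul => //|exact: pbounded_const].
move=> x s rep; have [_ _ _ sb] := rep.
pose out i := catrev (flatten [seq G (x, j) | j <- iota 0 i]) (s 2).
pose st i := upd (upd (upd s 2 (out i)) b (nseq (N x - i) true)) b.+1 (nseq i true).
have W := within_count (r := b) (P := body) (st := st) (n := N x) (B := h' x + 3) _ _ _.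
apply: within_ext (within_seq (runN _ _ rep)
  (within_seq (W _ _ _ _) (within_clear _ _))) (frefl _) _ _ => //.
- by move=> r; rewrite /st /upd subn0 /=; upd_cases => //; rewrite sb.
- by move=> i _; rewrite /st /upd; upd_cases.
- move=> i lt_i; have rep2 : @represents (ext C) (b.+1 :: loc) b.+2 (x, i) (st i).
    apply: (represents_ext lb); last by rewrite /st /upd; upd_cases.
    apply: (represents_agree lb (represents_out (out i) b2 loc2 rep)) => r le.
      by rewrite /st /upd; upd_cases.
    by rewrite /st /upd; upd_cases => //; rewrite sb //; lia.
  apply: within_ext (within_seq (run _ _ rep2) (within_seq (within_push _ _ _) (within_pop _ _)))
    (frefl _) _ _ => //.
  + move=> r; rewrite /st /upd; upd_cases => //; rewrite ?behead_nseq ?subnS //.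
    by rewrite /out iota0_rcons map_rcons flatten_rcons !catrevE rev_cat catA.
  + by have := le_h' x i (ltnW lt_i); lia.
- by move=> r; rewrite /st /upd subnn; upd_cases => //; rewrite sb.
- by rewrite /st /upd; upd_cases; rewrite size_nseq.
Qed.

End Emit.

Definition string_ctx : ctx := @Ctx (seq bool) id (fun=> [::]) [::].

Lemma emits_polytime (f : seq bool -> seq bool) :
  @emits string_ctx f -> polytime_computable f.
Proof.
case=> bf ef; have [//|||P [h [bh run]]] := ef [::] 3 => //.
have [d le_d] : @pbounded string_ctx (fun x => h x + (size x * 3 + 1 + (size (f x) * 7 + 1))).
  do ![apply: pbounded_add => //|apply: pbounded_mul => //|exact: pbounded_const].
  exact: (pbounded_tape0 string_ctx).
(* The output has accumulated in reverse, and moving it to the cleared register 0 reverses it once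
   more. *)
apply: (@prog_polytime_computable f (Seq P (Seq (clear 0) (move_bits 2 0))) d) => x.
have rep : @represents string_ctx [::] 3 x (nth [::] [:: x]).
  by split=> // -[|[|r]].
exists (upd (upd (nth [::] [:: x]) 2 [::]) 0 (f x)); last by [].
apply: within_ext (within_seq (run x _ rep) (within_seq (within_clear _ _) (within_move_bits _ _)))
  (frefl _) _ _ => //.
  move=> r; rewrite /upd; upd_cases => //=.
  by rewrite -!/(rev _) revK.
have := le_d x; rewrite /meas /= !addn0 /upd /=.
by rewrite -/(rev _) size_rev.
Qed.

Definition pair_ctx : ctx := @Ctx (seq bool * seq bool) fst snd [::].

Lemma pdecidable_NP (A : language) (V : pair_ctx -> bool) e f :
  pdecidable V ->
  (forall x, A x <-> exists y, size y <= poly_bound e f (size x) /\ V (x, y)) -> NP A.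
Proof.
case=> bV pV; have [//|P [h [[d le_d] run]]] := pV [::] 2.
apply: (@prog_NP A (fun x y => V (x, y)) P 2 d) => x y.
have rep : @represents pair_ctx [::] 2 (x, y) (nth [::] [:: x; y]).
  by split=> // -[|[|r]] // _; rewrite nth_default.
exists (upd (nth [::] [:: x; y]) 2 (nseq (V (x, y)) true)).
  apply: within_ext (run _ _ rep) (frefl _) (frefl _) _.
  by have := le_d (x, y); rewrite /meas /= addn0.
by rewrite /upd eqxx; case: (V _).
Qed.

(** * Coloring and containment-free representations *)

Definition colorable (H : rel nat) (N k : nat) : Prop :=
  exists col : nat -> nat, (forall i, i < N -> col i < k) /\
    forall i j, i < N -> j < N -> H i j -> col i <> col j.

Definition join_adj (H : rel nat) (N : nat) : rel nat :=
  fun i j => (i != j) && (if i < N then (j < N) ==> ~~ H i j else j < N).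

Lemma join_adj_sym H N : symmetric H -> symmetric (join_adj H N).
Proof.
move=> symH i j; rewrite /join_adj eq_sym symH; congr (_ && _).
by case: (i < N); case: (j < N).
Qed.

Lemma join_adj_irr H N : irreflexive (join_adj H N).
Proof. by move=> i; rewrite /join_adj eqxx. Qed.

Definition join_graph (H : rel nat) (symH : symmetric H) (N : nat) : graph :=
  @Graph (N + (N * N).+1) (fun i j => join_adj H N i j)
    (fun i j => join_adj_sym N symH i j) (fun i => join_adj_irr H N i).

Definition join_size (N k : nat) : nat := (N * N).+1 * k + N * N.

(** Containment-freeness settles two of the three conditions of [overlap] for distinct vertices; an
    intersection representation remains. *)
Lemma cf_overlap_meet (G : graph) (U : finType) (S : 'I_(order G) -> {set U}) :
  containment_free S ->
  overlap_representation S <->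
  (forall u v, u != v -> adj u v = (S u :&: S v != set0)).
Proof.
move=> cf; split=> [rep u v uv|rep u v].
  by rewrite rep /overlap !cf ?andbT // eq_sym.
case: (eqVneq u v) => [->|uv]; first by rewrite adj_irr /overlap subxx /= andbF.
by rewrite rep // /overlap !cf ?andbT // eq_sym.
Qed.

Section Join.
Variables (H : rel nat) (symH : symmetric H) (irrH : irreflexive H) (N k : nat).
Let t := (N * N).+1.
Let G := join_graph symH N.

Lemma colorable_join : 1 < k -> colorable H N k -> cf_overlap_number (G, join_size N k).
Proof.
move=> k1 [col [col_lt col_neq]].
pose U : finType := (('I_t * 'I_k) + ('I_N * 'I_N))%type.
(* The element [(w, c)] is the independent vertex [w] together with color class [c], a clique of the
   complement. The element [(p, q)] is the edge from [p] to [q], or [p] alone if they are not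
   adjacent; in particular [(a, a)] is private to [a] and separates it from all other vertices. *)
pose S' (v : 'I_N + 'I_t) : {set U} := [set x : U |
  match v, x with
  | inl a, inl (_, c) => c == col a :> nat
  | inl a, inr (p, q) => (p == a) || (q == a) && join_adj H N p q
  | inr w, inl (w', _) => w' == w
  | inr _, inr _ => false
  end].
pose S (v : 'I_(order G)) := S' (split v).
have Sl a : S (lshift t a) = S' (inl a) by rewrite /S -[lshift t a]/(unsplit (inl a)) unsplitK.
have Sr w : S (rshift N w) = S' (inr w) by rewrite /S -[rshift N w]/(unsplit (inr w)) unsplitK.
have cf : containment_free S.
  move=> u v; case: (split_ordP u) => a ->; case: (split_ordP v) => b -> uv;
    rewrite ?Sl ?Sr; apply/subsetPn.
  - exists (inr (a, a)); rewrite inE ?eqxx //=.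
    by move: uv; rewrite (inj_eq (@lshift_inj _ _)) => /negPf ->.
  - by exists (inr (a, a)); rewrite inE ?eqxx.
  (* Two colors are needed here: [b] shares with the independent vertex only the element of its own
     color. *)
  - have [c neq_c] : exists c : 'I_k, c != col b :> nat.
      case: (eqVneq (col b) 0) => [->|]; first by exists (Ordinal k1).
      by exists (Ordinal (ltnW k1)); rewrite eq_sym.
    by exists (inl (a, c)); rewrite inE ?eqxx.
  - exists (inl (a, Ordinal k1)); rewrite inE ?eqxx //=.
    by move: uv; rewrite (inj_eq (@rshift_inj _ _)) => /negPf ->.
exists U, S; split=> //=.
  apply/cf_overlap_meet => // u v; rewrite /=.
  have adjl (a b : 'I_N) : join_adj H N a b = (a != b) && ~~ H a b.
    by rewrite /join_adj /= !ltn_ord.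
  have adjr (a : 'I_N) (w : 'I_t) : join_adj H N a (N + w).
    by rewrite /join_adj ltn_ord ltnNge leq_addr /= andbT; have := ltn_ord a; lia.
  case: (split_ordP u) => a ->; case: (split_ordP v) => b -> uv; rewrite ?Sl ?Sr /=.
  - rewrite adjl; move: uv; rewrite (inj_eq (@lshift_inj _ _)) => ab.
    apply/idP/set0Pn; rewrite ab /=.
      move=> nHab; exists (inr (a, b)); rewrite !inE !eqxx /=.
      by rewrite adjl ab nHab orbT.
    case=> -[[w c]|[p q]]; rewrite !inE.
      by case/andP=> /eqP ca /eqP cb; apply/negP => /col_neq; apply; rewrite -?ca -?cb.
    have Hab (p' q' : 'I_N) : join_adj H N p' q' -> ~~ H p' q'.
      by rewrite adjl => /andP[].
    case/andP=> /orP[/eqP -> | /andP[/eqP -> /Hab Hpa]] /orP[/eqP e | /andP[/eqP e /Hab Hpb]].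
    + by rewrite e eqxx in ab.
    + by rewrite -e.
    + by rewrite symH -e.
    + by rewrite e eqxx in ab.
  - rewrite adjr; apply/esym/set0Pn.
    by exists (inl (b, Ordinal (col_lt a (ltn_ord a)))); rewrite !inE !eqxx.
  - rewrite join_adj_sym // adjr; apply/esym/set0Pn.
    by exists (inl (a, Ordinal (col_lt b (ltn_ord b)))); rewrite !inE !eqxx.
  - rewrite /join_adj /= !ltnNge !leq_addr /= andbF; apply/esym/set0Pn => -[[[w c]|[p q]]];
      rewrite !inE ?andbF // => /andP[/eqP e1 /eqP e2].
    by rewrite -e1 -e2 eqxx in uv.
rewrite /representation_size (_ : \bigcup_v S v = setT).
  by rewrite cardsT card_sum !card_prod !card_ord.
apply/setP => x; rewrite [RHS]inE; apply/bigcupP; case: x => [[w c]|[p q]].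
  by exists (rshift N w); rewrite // Sr inE.
by exists (lshift t p); rewrite // Sl inE eqxx.
Qed.

Lemma join_colorable : cf_overlap_number (G, join_size N k) -> colorable H N k.
Proof.
case=> U [S [/= rep cf size_S]]; have meet := (cf_overlap_meet cf).1 rep.
pose F (w : 'I_t) := S (rshift N w).
have disj w w' : w != w' -> [disjoint F w & F w'].
  move=> ww'; rewrite -setI_eq0 -[_ == _]negbK -meet.
    by rewrite /= /join_adj /= !ltnNge !leq_addr andbF.
  by rewrite (inj_eq (@rshift_inj _ _)).
(* The sets [F w] are pairwise disjoint, so [t] of them with more than [k] elements each would
   exceed [join_size N k] by one. *)
have [w le_w] : exists w, #|F w| <= k.
  apply/existsP; rewrite -[[exists _, _]]negbK negb_exists; apply/negP => /forallP gt_k.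
  have : \sum_(w < t) k.+1 <= \sum_(w < t) #|F w|.
    by apply: leq_sum => w _; rewrite ltnNge.
  have -> : \sum_(w < t) #|F w| = #|\bigcup_w F w|.
    rewrite -sum1_card (partition_disjoint_bigcup _ _ disj).
    by apply: eq_bigr => w _; rewrite sum1_card.
  have : #|\bigcup_w F w| <= join_size N k.
    rewrite -size_S; apply/subset_leq_card/bigcupsP => w _.
    exact: (bigcup_sup (rshift N w)).
  rewrite sum_nat_const card_ord /join_size -/t mulnS; rewrite /t; lia.
have pick_elt (a : 'I_N) : exists x, x \in S (lshift t a) :&: F w.
  apply/set0Pn; rewrite -meet.
    by rewrite /= /join_adj /= ltn_ord ltnNge leq_addr /= andbT; have := ltn_ord a; lia.
  by rewrite eq_lrshift.
pose e (a : 'I_N) := xchoose (pick_elt a).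
have eP a : (e a \in S (lshift t a)) /\ (e a \in F w).
  by apply/andP; rewrite -in_setI; apply: xchooseP.
(* The color of [a] names an element shared by [a] and [w]. Vertices of equal color share that
   element, so they are adjacent in the complement and not in [H]. *)
exists (fun i => if insub i is Some a then index (e a) (enum (F w)) else 0); split=> [i lt_i|i j lt_i lt_j Hij].
  rewrite insubT; apply: leq_trans le_w; rewrite cardE index_mem mem_enum.
  by case: (eP (Sub i lt_i)).
rewrite !insubT; set a : 'I_N := Sub i lt_i; set b : 'I_N := Sub j lt_j => eq_ab.
have {}eq_ab : e a = e b.
  by rewrite -(nth_index (e a) (_ : e a \in enum (F w))) ?mem_enum ?(eP a).2 //
    eq_ab nth_index // mem_enum (eP b).2.
case: (eqVneq a b) => [/(congr1 val) /= ij|ab]; first by rewrite ij irrH in Hij.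
have : adj (g := G) (lshift t a) (lshift t b).
  rewrite meet ?(inj_eq (@lshift_inj _ _)) //; apply/set0Pn; exists (e a).
  by rewrite inE (eP a).1 eq_ab (eP b).1.
by rewrite /= /join_adj /= lt_i lt_j Hij andbF.
Qed.

End Join.

(** * Constraint satisfaction and coloring *)

(* Variables [u < n] take values [v < d]; the literal [c = u * d + v] belongs
   to clause [z] if [inc z c], and a clause asks for one of its literals to be
   violated. *)
Definition satisfiable (n d m : nat) (inc : rel nat) : Prop :=
  exists2 sigma : nat -> nat, (forall u, u < n -> sigma u < d) &
    forall z, z < m -> exists2 c, c < n * d & inc z c && (sigma (c %/ d) != c %% d).

(* Vertices below [n * d] are the colors, then come the variables, each of
   which may only use its own literals as colors, and the clauses, which may
   only use their literals. *)
Definition palette_arc (n d : nat) (inc : rel nat) : rel nat := fun i j =>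
  if i < n * d then (j < n * d) && (i != j)
  else if i < n * d + n then (j < n * d) && (j %/ d != i - n * d)
  else if j < n * d then ~~ inc (i - (n * d + n)) j
  else j < n * d + n.

Definition palette_adj (n d : nat) (inc : rel nat) : rel nat :=
  fun i j => palette_arc n d inc i j || palette_arc n d inc j i.

Lemma palette_adj_sym n d inc : symmetric (palette_adj n d inc).
Proof. by move=> i j; rewrite /palette_adj orbC. Qed.

Lemma palette_adj_irr n d inc : irreflexive (palette_adj n d inc).
Proof.
move=> i; rewrite /palette_adj orbb /palette_arc eqxx andbF.
by case: ltnP => // _; case: ifP.
Qed.

Section Palette.
Variables (n d m : nat) (inc : rel nat).
Let H := palette_adj n d inc.
Let N := n * d + n + m.

(** A variable takes the literal that holds for it and a clause takes a violated literal of its own,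
    so these two kinds of vertices never share a color. *)
Lemma satisfiable_colorable : satisfiable n d m inc -> colorable H N (n * d).
Proof.
case=> sigma sigma_lt sat.
pose lit z c := inc z c && (sigma (c %/ d) != c %% d).
pose pick_lit z := find (lit z) (iota 0 (n * d)).
pose col i := if i < n * d then i else
  if i < n * d + n then (i - n * d) * d + sigma (i - n * d) else pick_lit (i - (n * d + n)).
have pick_lt z : z < m -> pick_lit z < n * d.
  case/sat=> c lt_c lit_c; rewrite /pick_lit -{2}(size_iota 0 (n * d)) -has_find.
  by apply/hasP; exists c; rewrite ?mem_iota.
have pick_lit_ok z : z < m -> lit z (pick_lit z).
  move=> lt_z; have lt_p := pick_lt _ lt_z.
  have has_z : has (lit z) (iota 0 (n * d)) by rewrite has_find size_iota.
  by have := nth_find 0 has_z; rewrite -/(pick_lit z) nth_iota.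
have var_div u : u < n -> (u * d + sigma u) %/ d = u.
  by move=> lt_u; have := sigma_lt _ lt_u; move=> lt_s; rewrite divnMDl ?divn_small ?addn0 //; lia.
have var_mod u : u < n -> (u * d + sigma u) %% d = sigma u.
  by move=> lt_u; rewrite modnMDl modn_small // sigma_lt.
have arc_neq i j : i < N -> j < N -> palette_arc n d inc i j -> col i <> col j.
  rewrite /N /palette_arc /col => lt_i lt_j.
  case: (ltnP i (n * d)) => [i1|i1].
    by case/andP=> lt_jd /eqP; rewrite lt_jd.
  case: (ltnP i (n * d + n)) => [i2|i2].
    case/andP=> lt_jd /eqP neq; rewrite lt_jd => eq_j; apply: neq.
    by rewrite -eq_j var_div //; lia.
  have lt_z : i - (n * d + n) < m by lia.
  have /andP[inc_z viol] := pick_lit_ok _ lt_z.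
  case: (ltnP j (n * d)) => [j1|j1]; first by move=> /negP ninc eq_j; rewrite -eq_j in ninc.
  move=> j2; rewrite j2 => eq_j; rewrite eq_j in viol.
  by rewrite var_div ?var_mod ?eqxx // in viol; lia.
exists col; split=> [i lt_i|i j lt_i lt_j /orP[|] arc].
- rewrite /col; case: (ltnP i (n * d)) => // i1; case: (ltnP i (n * d + n)) => i2; last by apply: pick_lt; lia.
  have lt_u : i - n * d < n by lia.
  by have := sigma_lt _ lt_u; nia.
- exact: arc_neq.
- by move=> eq_ij; apply: (arc_neq j i lt_j lt_i arc).
Qed.

(** The color clique uses every color once, so each vertex has the color of a unique literal: for a
    variable it is one of its own, for a clause one of the clause. The latter is violated, since
    otherwise the clause would share its color with an adjacent variable vertex. *)
Lemma colorable_satisfiable : colorable H N (n * d) -> satisfiable n d m inc.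
Proof.
case=> col [col_lt col_neq].
pose cols := [seq col c | c <- iota 0 (n * d)].
have col_inj i j : i < n * d -> j < n * d -> col i = col j -> i = j.
  move=> lt_i lt_j eq_c; apply/eqP/negPn/negP => neq.
  apply: (col_neq i j _ _ _ eq_c); rewrite /N; try lia.
  by rewrite /H /palette_adj /palette_arc lt_i lt_j /= neq.
have cols_all x : x < n * d -> x \in cols.
  have uniq_cols : uniq cols.
    by rewrite map_inj_in_uniq ?iota_uniq // => i j; rewrite !mem_iota; apply: col_inj.
  have sub : {subset cols <= iota 0 (n * d)}.
    by move=> _ /mapP[c c_in ->]; move: c_in; rewrite !mem_iota /= => lt_c; apply: col_lt; rewrite /N; lia.
  have [|_ eq_cols] := uniq_min_size uniq_cols sub; first by rewrite size_map.
  by rewrite eq_cols mem_iota.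
have inv i : i < N -> exists2 c, c < n * d & col c = col i.
  move=> lt_i; have /mapP[c] := cols_all _ (col_lt _ lt_i).
  by rewrite mem_iota => /andP[_ lt_c] ->; exists c.
pose val u := index (col (n * d + u)) cols.
have valP u : u < n -> [/\ val u < n * d, col (val u) = col (n * d + u) & val u %/ d = u].
  move=> lt_u; have lt_N : n * d + u < N by rewrite /N; lia.
  have in_cols := cols_all _ (col_lt _ lt_N).
  have lt_v : val u < n * d.
    by have := in_cols; rewrite -index_mem size_map size_iota.
  have col_v : col (val u) = col (n * d + u).
    by rewrite -[RHS](nth_index 0 in_cols) (nth_map 0) ?size_iota // nth_iota.
  split=> //; apply/eqP/negPn/negP => neq.
  apply: (col_neq (n * d + u) (val u) _ _ _ (esym col_v)) => //; rewrite /N; try lia.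
  rewrite /H /palette_adj /palette_arc ltnNge leq_addr /= ltn_add2l lt_u lt_v /=.
  by rewrite addKn neq.
exists (fun u => val u %% d) => [u lt_u|z lt_z].
  by rewrite ltn_mod; have [] := valP _ lt_u; lia.
have lt_N : n * d + n + z < N by rewrite /N; lia.
have [c lt_c col_c] := inv _ lt_N.
have d0 : 0 < d by lia.
have lt_u : c %/ d < n by rewrite ltn_divLR.
exists c => //; apply/andP; split.
  apply/negPn/negP => ninc.
  apply: (col_neq (n * d + n + z) c _ _ _ (esym col_c)); rewrite /N; try lia.
  rewrite /H /palette_adj /palette_arc -addnA ltnNge leq_addr /= addnA.
  by rewrite ltnNge leq_addr /= lt_c addKn ninc.
have [lt_v col_v div_v] := valP _ lt_u.
apply/eqP => eq_mod; have eq_vc : val (c %/ d) = c.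
  by rewrite (divn_eq (val _) d) div_v eq_mod -divn_eq.
apply: (col_neq (n * d + n + z) (n * d + c %/ d)).
- by [].
- by rewrite /N; lia.
- rewrite /H /palette_adj /palette_arc -addnA ltnNge leq_addr /= addnA.
  by rewrite ltnNge leq_addr /= ltnNge leq_addr /= ltn_add2l lt_u.
- by rewrite -col_v eq_vc.
Qed.

End Palette.

(** * The reduction in polynomial time *)

(** Brings the number of binary digits within reach of [ptime_count_iota]; since [k < 2 ^ k],
    positions below [k] suffice. *)
Lemma up_log_count k : count (fun i => 0 < k %/ 2 ^ i) (iota 0 k) = up_log 2 k.+1.
Proof.
have lt_log i : (0 < k %/ 2 ^ i) = (i < up_log 2 k.+1).
  rewrite divn_gt0 ?expn_gt0 // ltnNge; apply/idP/negP => [le_k le_i|lt_i].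
    have := leq_trans (up_logP k.+1 (isT : 1 < 2)) (leq_pexp2l (isT : 0 < 2) le_i).
    by rewrite ltnNge le_k.
  by rewrite leqNgt; apply/negP => gt_k; apply: lt_i; apply: up_log_min.
rewrite (eq_count lt_log) count_ltn_iota //.
by apply: up_log_min => //; apply: ltn_expl.
Qed.

Lemma flatten_bits (T U : Type) (f : T -> U) s : flatten [seq [:: f i] | i <- s] = [seq f i | i <- s].
Proof. by elim: s => //= i s ->. Qed.

Lemma emits_map (C : ctx) (N : C -> nat) (P : ext C -> bool) : ptime N -> pdecidable P ->
  emits (fun x => [seq P (x, i) | i <- iota 0 (N x)]).
Proof.
move=> pN pP; apply: emits_ext (emits_iota pN (emits_bit pP)) => x.
exact: flatten_bits.
Qed.

Lemma emits_binary (C : ctx) (K : C -> nat) : ptime K -> emits (fun x => binary (K x)).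
Proof.
move=> pK.
have p_log : ptime (fun x => up_log 2 (K x).+1).
  apply: ptime_ext (fun x => up_log_count (K x)) _.
  apply: (ptime_count_iota (P := fun z => 0 < K z.1 %/ 2 ^ z.2)) => //.
  exact: (pdecidable_ltn (ptime_const _ 0) (ptime_div_expn2 (ptime_lift pK) (ptime_newest _))).
apply: (emits_map (P := fun z => odd (K z.1 %/ 2 ^ z.2)) p_log).
exact: (pdecidable_odd (ptime_div_expn2 (ptime_lift pK) (ptime_newest _))).
Qed.

Lemma emits_instance (C : ctx) (G : C -> graph) (K N : C -> nat) (e : C -> rel nat) :
  (forall x, order (G x) = N x) ->
  (forall x (i j : 'I_(order (G x))), adj i j = e x i j) ->
  ptime N -> ptime K -> @pdecidable (ext (ext C)) (fun z => e z.1.1 z.1.2 z.2) ->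
  emits (fun x => encode_instance (G x, K x)).
Proof.
move=> order_G adj_G pN pK p_e.
have e1 : emits (fun x => [seq true | i <- iota 0 (N x)]).
  by apply: (emits_map (P := fun=> true) pN); apply: pdecidable_const.
have e2 : emits (fun x => flatten [seq [seq e x i j | j <- iota 0 (N x)] | i <- iota 0 (N x)]).
  apply: (emits_iota (G := fun z => [seq e z.1 z.2 j | j <- iota 0 (N z.1)]) pN).
  exact: (@emits_map (ext C) _ (fun z => e z.1.1 z.1.2 z.2) (ptime_lift pN) p_e).
have e3 := emits_bit (pdecidable_const C false).
apply: emits_ext (emits_cat e1 (emits_cat e3 (emits_cat e2 (emits_binary pK)))) => x.
rewrite /encode_instance /= -order_G; congr (_ ++ false :: _ ++ _).
  by elim: (order _) 0 => //= n IH i; rewrite IH.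
rewrite -val_enum_ord; congr flatten; rewrite -[LHS]map_comp.
apply: eq_map => i /=; rewrite -map_comp; apply: eq_map => j /=.
by rewrite adj_G.
Qed.

(** The parameters must be computable in every context, because adjacency is evaluated under the two
    binders that range over the matrix. The condition [1 < n x * d x] supplies the two colors that
    [colorable_join] requires. *)
Lemma satisfiable_reduction (A : language) (n d m : seq bool -> nat) (inc : seq bool -> rel nat) :
  (forall C : ctx, ptime (fun x : C => n (tape0 x))) ->
  (forall C : ctx, ptime (fun x : C => d (tape0 x))) ->
  (forall C : ctx, ptime (fun x : C => m (tape0 x))) ->
  (forall (C : ctx) (F G : C -> nat), ptime F -> ptime G ->
     pdecidable (fun x => inc (tape0 x) (F x) (G x))) ->
  (forall x, 1 < n x * d x) ->
  (forall x, A x <-> satisfiable (n x) (d x) (m x) (inc x)) ->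
  polytime_reducible A cf_overlap_language.
Proof.
move=> pn pd pm p_inc nd1 A_sat.
pose N x := n x * d x + n x + m x.
pose H x := palette_adj (n x) (d x) (inc x).
pose G x := join_graph (palette_adj_sym (n x) (d x) (inc x)) (N x).
pose K x := join_size (N x) (n x * d x).
have pN (C : ctx) : ptime (fun x : C => N (tape0 x)).
  exact: (ptime_add (ptime_add (ptime_mul (pn C) (pd C)) (pn C)) (pm C)).
exists (fun x => encode_instance (G x, K x)).
  apply: emits_polytime.
  apply: (@emits_instance string_ctx G K (fun x => N x + (N x * N x).+1)
    (fun x => join_adj (H x) (N x))) => //.
  - exact: (ptime_add (pN string_ctx) (ptime_succ (ptime_mul (pN _) (pN _)))).
  - have pnd := ptime_mul (pn string_ctx) (pd string_ctx).
    exact: (ptime_add (ptime_mul (ptime_succ (ptime_mul (pN string_ctx) (pN _))) pnd)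
      (ptime_mul (pN _) (pN _))).
  - pose C2 := ext (ext string_ctx).
    have p_i : @ptime C2 (fun z => z.1.2) by exact: (ptime_lift (ptime_newest string_ctx)).
    have p_j : @ptime C2 snd by exact: ptime_newest.
    have pn2 := pn C2; have pd2 := pd C2; have pN2 := pN C2.
    have p_nd := ptime_mul pn2 pd2; have p_ndn := ptime_add p_nd pn2.
    have p_arc F1 F2 : @ptime C2 F1 -> @ptime C2 F2 ->
        @pdecidable C2 (fun z => palette_arc (n z.1.1) (d z.1.1) (inc z.1.1) (F1 z) (F2 z)).
      move=> p1 p2; apply: pdecidable_if; first exact: (pdecidable_ltn p1 p_nd).
        exact: (pdecidable_and (pdecidable_ltn p2 p_nd) (pdecidable_not (pdecidable_eqn p1 p2))).
      apply: pdecidable_if; first exact: (pdecidable_ltn p1 p_ndn).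
        exact: (pdecidable_and (pdecidable_ltn p2 p_nd)
          (pdecidable_not (pdecidable_eqn (ptime_divn p2 pd2) (ptime_sub p1 p_nd)))).
      apply: pdecidable_if; first exact: (pdecidable_ltn p2 p_nd).
        exact: (pdecidable_not (p_inc C2 _ _ (ptime_sub p1 p_ndn) p2)).
      exact: (pdecidable_ltn p2 p_ndn).
    apply: pdecidable_and; first exact: (pdecidable_not (pdecidable_eqn p_i p_j)).
    apply: pdecidable_if; first exact: (pdecidable_ltn p_i pN2).
      apply: pdecidable_imply; first exact: (pdecidable_ltn p_j pN2).
      exact: (pdecidable_not (pdecidable_or (p_arc _ _ p_i p_j) (p_arc _ _ p_j p_i))).
    exact: (pdecidable_ltn p_j pN2).
move=> x; rewrite A_sat cf_overlap_languageP; split=> [/satisfiable_colorable|].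
  exact: colorable_join.
move/join_colorable => col; apply: colorable_satisfiable; apply: col.
exact: palette_adj_irr.
Qed.

(** * The computation tableau *)

Section Tableau.
Variable M : tm.

(* Tracks are the state and, for each tape, the two halves of the tape counted
   from the head: [(i, false)] is the scanned cell and what follows it,
   [(i, true)] is what precedes it. *)
Definition track_index : finType := option ('I_(tapes M).+1 * bool).
Definition entry : finType := (state M + symbol M)%type.

Definition track (c : config M) (j : track_index) (p : nat) : entry :=
  match j with
  | None => inl (cstate c)
  | Some (i, false) => inr (nth None (cell (ctape c i) :: right (ctape c i)) p)
  | Some (i, true) => inr (nth None (left (ctape c i)) p)
  end.

Definition entry_symbol (v : entry) : symbol M := if v is inr a then a else None.

(* The heads do not move in this picture: an entry of the next row depends on
   its three neighbours and on the entries at position 0 of all tracks. *)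
Definition next_entry (j : track_index) (p : nat) (g : track_index -> entry)
    (prev mid next : entry) : entry :=
  let q := if g None is inl q then q else start M in
  if halting q then mid else
  let: (q', act) := delta q [ffun i => entry_symbol (g (Some (i, false)))] in
  match j with
  | None => inl q'
  | Some (i, side) =>
    let: (a, mv) := act i in
    match mv, side with
    | Stay, false => if p == 0 then inr a else mid
    | Stay, true => mid
    | MoveR, false => next
    | MoveR, true => if p == 0 then inr a else prev
    | MoveL, false =>
      if p == 0 then g (Some (i, true)) else if p == 1 then inr a else prev
    | MoveL, true => next
    end
  end.

(** The rule only tests whether the position is 0 or 1, so three classes of positions suffice and
    the clause kinds are finite in number. *)
Lemma next_entry_min j p : next_entry j (minn p 2) = next_entry j p.
Proof. by case: p => [|[|p]] //; rewrite minnSS minnSS minn0. Qed.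

(** At [p = 0] the left neighbour [p.-1] is the entry itself; this is harmless, as the rule reads
    [prev] only at positive positions. *)
Lemma track_step (c : config M) j p :
  track (step c) j p =
  next_entry j p (fun j' => track c j' 0) (track c j p.-1) (track c j p) (track c j p.+1).
Proof.
rewrite /next_entry /step /halted /=; case: (halting _) => //.
case: (delta _ _) => q' act.
case: j => [[i side]|] //=; case: (act i) => a [] /=; case: (ctape c i) => l s r;
  case: side; case: p => [|[|p]] //=; rewrite ?nth_nil //; try by case: l; try by case: r.
Qed.

(** The shapes of forbidden patterns, which depend on the machine only: a breach of the transition
    rule, with the position cut off at 2; a wrong entry in the first row; a blank followed by a bit
    on tape 1; a rejecting state in row [T]. *)
Definition clause_kind : finType :=
  ((track_index * 'I_3 * {ffun track_index -> entry} * (entry * entry * entry * entry)) +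
   (track_index * entry) + ('I_(tapes M).+1 * bool) + state M)%type.

Definition step_kind j k g a b c v : clause_kind := inl (inl (inl (j, k, g, (a, b, c, v)))).
Definition start_kind j v : clause_kind := inl (inl (inr (j, v))).
Definition gap_kind i b : clause_kind := inl (inr (i, b)).
Definition final_kind q : clause_kind := inr q.

(* The entries of the first row: tape 0 contains [x] and tape 1 contains bits
   at positions below [Y] or blanks. *)
Definition start_entry (x : seq bool) (Y : nat) (j : track_index) (v : entry) (p : nat) : bool :=
  match j, v with
  | None, _ => v == inl (start M)
  | Some (i, side), inr None => side || (i != 0 :> nat) || (size x <= p)
  | Some (i, false), inr (Some (inl b)) =>
    if i == 0 :> nat then (p < size x) && (nth false x p == b) else (i == 1 :> nat) && (p < Y)
  | _, _ => false
  end.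

(* Row [t] and position [p] range below [T.+2].  The literal [(t, j, p, v)]
   says that entry [p] of track [j] in row [t] is [v]; an active clause forbids
   its literals to hold simultaneously. *)
Definition active (x : seq bool) (Y T : nat) (th : clause_kind) (t p : nat) : bool :=
  match th with
  | inl (inl (inl (j, k, g, (a, b, c, v)))) =>
    [&& t <= T, p <= T, minn p 2 == k & v != next_entry j k g a b c]
  | inl (inl (inr (j, v))) => ~~ start_entry x Y j v p
  | inl (inr (i, b)) => (p <= T) && (i == 1 :> nat)
  | inr q => ~~ accepting q
  end.

Definition literals (T : nat) (th : clause_kind) (t p : nat) : seq (nat * track_index * nat * entry) :=
  match th with
  | inl (inl (inl (j, k, g, (a, b, c, v)))) =>
    [:: (t, j, p.-1, a); (t, j, p, b); (t, j, p.+1, c); (t.+1, j, p, v)] ++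
    [seq (t, j', 0, g j') | j' <- enum track_index]
  | inl (inl (inr (j, v))) => [:: (0, j, p, v)]
  | inl (inr (i, b)) =>
    [:: (0, Some (i, false), p, inr None); (0, Some (i, false), p.+1, inr (Some (inl b)))]
  | inr q => [:: (T, None, 0, inl q)]
  end.

Definition tableau (x : seq bool) (Y T : nat) (tau : nat -> track_index -> nat -> entry) : Prop :=
  forall t p th, t < T.+2 -> p < T.+2 -> active x Y T th t p ->
    has (fun l : nat * track_index * nat * entry =>
      let: (t', j, p', v) := l in tau t' j p' != v) (literals T th t p).

Lemma start_entryP x y Y (i : 'I_(tapes M).+1) side v p :
  size y <= Y -> track (initial M [:: x; y]) (Some (i, side)) p = v ->
  start_entry x Y (Some (i, side)) v p.
Proof.
move=> le_y <-; rewrite /=; case: side => /=.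
  by rewrite nth_nil.
have -> := string_tapeP M (nth [::] [:: x; y] i) p; rewrite nth_bits.
case: i => -[|[|i]] lt_i /=; case: ltnP => //=; rewrite ?eqxx ?andbT //.
- by move=> lt_p; apply: leq_trans le_y.
- by rewrite nth_nil.
Qed.

Lemma tableau_of_run x y Y T :
  size y <= Y -> accepting (cstate (run M [:: x; y] T)) ->
  tableau x Y T (fun t => track (run M [:: x; y] t)).
Proof.
move=> le_y acc t p [[[[[[j k] g] [[[a b] c] v]]|[j v]]|[i b]]|q] lt_t lt_p /=.
- case/and4P=> le_t le_p /eqP eq_k; rewrite -eq_k next_entry_min.
  apply: contraR; rewrite !negb_or !negbK has_map -all_predC.
  case/and5P=> /eqP <- /eqP <- /eqP <- /eqP <- /allP eq_g.
  rewrite track_step; apply/eqP; rewrite /next_entry.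
  have eq_g0 j' : track (run M [:: x; y] t) j' 0 = g j'.
    by have := eq_g j' (mem_enum _ _); rewrite /= negbK => /eqP.
  rewrite !eq_g0; case: (halting _) => //.
  rewrite (_ : [ffun i => _] = [ffun i => entry_symbol (g (Some (i, false)))]); last first.
    by apply/ffunP => i; rewrite !ffunE eq_g0.
  case: (delta _ _) => q' act; case: j {v a b c eq_k} => [[i side]|] //.
  case: (act i) => s [] //; case: side => //; case: (p == 0) => //; by rewrite eq_g0.
- rewrite orbF; apply: contraNN => /eqP.
  by case: j => [[i side]|] /=; [apply: start_entryP | move=> <-; rewrite eqxx].
- case/andP=> le_p i1; rewrite orbF -negb_and; apply/negP => /andP[/eqP[]].
  have := string_tapeP M (nth [::] [:: x; y] i) p; rewrite /= nth_bits => ->.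
  have := string_tapeP M (nth [::] [:: x; y] i) p.+1; rewrite /= nth_bits => ->.
  by case: ltnP => // le _; case: ltnP => //; lia.
- rewrite orbF; apply: contraNN => /eqP[<-] //.
Qed.

Section RunOfTableau.
Variables (x : seq bool) (Y T : nat) (tau : nat -> track_index -> nat -> entry).
Hypothesis tabl : tableau x Y T tau.

Lemma tableau_start j p : p < T.+2 -> start_entry x Y j (tau 0 j p) p.
Proof.
move=> lt_p; apply/negPn/negP => bad.
by have := tabl (th := start_kind j (tau 0 j p)) (ltn0Sn _) lt_p bad; rewrite /= eqxx.
Qed.

Lemma tableau_step t j p : t <= T -> p <= T ->
  tau t.+1 j p = next_entry j p (fun j' => tau t j' 0) (tau t j p.-1) (tau t j p) (tau t j p.+1).
Proof.
move=> le_t le_p; apply/eqP/negPn/negP => bad.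
pose g : {ffun track_index -> entry} := [ffun j' => tau t j' 0].
have lt_k : minn p 2 < 3 by lia.
pose th := step_kind j (Ordinal lt_k) g (tau t j p.-1) (tau t j p) (tau t j p.+1) (tau t.+1 j p).
have next_g : next_entry j p g = next_entry j p (fun j' => tau t j' 0).
  (* A clause kind stores the entries at position 0 as a finite function, whereas [next_entry] takes
     an ordinary one. *)
  have -> : g = (fun j' => tau t j' 0) :> (_ -> _) by apply: functional_extensionality => j'; rewrite ffunE.
  by [].
have act : active x Y T th t p by rewrite /= le_t le_p eqxx next_entry_min next_g bad.
have := tabl (leq_trans le_t (leqnSn _)) (leq_trans le_p (leqnSn _)) act.
rewrite /= !eqxx /= has_map => /hasP[j' _] /=.
by rewrite ffunE eqxx.
Qed.

Definition entry_bit (v : entry) : option bool := if v is inr (Some (inl b)) then Some b else None.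

Lemma tableau_certificate : exists2 y, size y <= Y &
  forall j p, p < T.+2 -> tau 0 j p = track (initial M [:: x; y]) j p.
Proof.
(* A machine with a single tape sees no certificate, so the empty one will do. *)
have [tapes1|tapes0] := ltnP 1 (tapes M).+1; last first.
  exists [::] => // j p lt_p; have := tableau_start j lt_p.
  case: j => [[i side]|] /=; last by move/eqP.
  have i0 : i = 0 :> nat by have := ltn_ord i; lia.
  have := string_tapeP M (nth [::] [:: x; [::]] i) p; rewrite /= nth_bits i0 => ->.
  case: side; rewrite ?nth_nil; case: (tau _ _ _) => [q|[[b|a]|]] //=.
    by case/andP=> -> /eqP ->.
  by rewrite leqNgt => /negPf ->.
pose i1 : 'I_(tapes M).+1 := Ordinal tapes1.
pose bit p := entry_bit (tau 0 (Some (i1, false)) p).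
(* The certificate consists of the bits before the first blank of tape 1; the gap clauses propagate
   that blank to the rest of the row. *)
pose L := find (fun p => bit p == None) (iota 0 T.+2).
have before p : p < L -> tau 0 (Some (i1, false)) p = inr (Some (inl (odflt false (bit p)))).
  move=> lt_L; have lt_p : p < T.+2.
    by apply: leq_trans lt_L _; rewrite -[leqRHS](size_iota 0) find_size.
  have := before_find 0 lt_L; rewrite nth_iota // add0n /bit /entry_bit.
  by case: (tau _ _ _) => [q|[[b|a]|]].
have after p : L <= p -> p < T.+2 -> tau 0 (Some (i1, false)) p = inr None.
  have blank p' : p' < T.+2 -> bit p' = None -> tau 0 (Some (i1, false)) p' = inr None.
    move=> lt_p; have := tableau_start (Some (i1, false)) lt_p; rewrite /bit.
    by case: (tau _ _ _) => [q|[[b|a]|]].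
  elim: p => [|p IHp] le_L lt_p; apply: blank => //.
    have has_L : has (fun p => bit p == None) (iota 0 T.+2).
      by rewrite has_find size_iota (leq_ltn_trans le_L).
    by have := nth_find 0 has_L; rewrite -/L nth_iota ?(leq_ltn_trans le_L) // => /eqP;
       move: le_L; rewrite leqn0 => /eqP ->.
  move: le_L; rewrite leq_eqVlt => /predU1P[eq_L|le_L].
    have has_L : has (fun p => bit p == None) (iota 0 T.+2) by rewrite has_find size_iota -/L eq_L.
    by have := nth_find 0 has_L; rewrite -/L nth_iota eq_L // => /eqP.
  have prev := IHp le_L (ltnW lt_p).
  case bit_p: (bit p.+1) => [b|] //.
  have act : active x Y T (gap_kind i1 b) 0 p by rewrite /= andbT -ltnS.
  have := tabl (ltn0Sn _) (ltnW lt_p) act; rewrite /= prev eqxx /= orbF.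
  move: bit_p; rewrite /bit /entry_bit.
  by case: (tau _ _ _) => [q|[[b'|a]|]] //= [->]; rewrite eqxx.
exists (mkseq (fun p => odflt false (bit p)) L) => [|j p lt_p].
  (* The last certificate bit stands at position [L - 1], and the start clauses admit bits on tape 1
     only below [Y]. *)
  rewrite size_mkseq; case E: L => [|l] //.
  have lt_l : l < L by rewrite E.
  have lt_p : l < T.+2 by apply: leq_trans lt_l _; rewrite -[leqRHS](size_iota 0) find_size.
  by have := tableau_start (Some (i1, false)) lt_p; rewrite (before l lt_l).
have := tableau_start j lt_p.
case: j => [[i side]|] /=; last by move/eqP.
set y := mkseq _ _.
have := string_tapeP M (nth [::] [:: x; y] i) p; rewrite /= => ->.
rewrite nth_bits; case: side.
  by rewrite nth_nil; case: (tau _ _ _) => [q|[[b|a]|]].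
case: (eqVneq (i : nat) 1) => [ei|i1'].
  have -> : i = i1 by apply: val_inj.
  move=> _; rewrite /= size_mkseq; case: ltnP => [lt_L|le_L]; last exact: after.
  by rewrite before // nth_mkseq.
case: (eqVneq (i : nat) 0) => [->|i0] /=.
  case: (tau _ _ _) => [q|[[b|a]|]] //=; first by case/andP=> -> /eqP ->.
  by rewrite leqNgt => /negPf ->.
have -> : nth [::] [:: x; y] i = [::] by case: (i : nat) i0 i1' => [|[|n]] //=; rewrite nth_nil.
by case: (tau _ _ _) => [q|[[b|a]|]].
Qed.

Lemma run_of_tableau : exists2 y, size y <= Y & accepting (cstate (run M [:: x; y] T)).
Proof.
have [y le_y start_tau] := tableau_certificate; exists y => //.
(* The rule reads the right neighbour and is not imposed in the last column, so the part of the
   tableau known to be correct shrinks by one cell per row. The width [T.+2] keeps position 0 of row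
   [T] inside. *)
have tauE t j p : t + p < T.+2 -> tau t j p = track (run M [:: x; y] t) j p.
  elim: t j p => [|t IHt] j p lt_tp; first exact: start_tau.
  rewrite tableau_step; try lia.
  rewrite /= track_step !IHt; try lia.
  have eq_g : (fun j' => tau t j' 0) = (fun j' => track (run M [:: x; y] t) j' 0).
    by apply: functional_extensionality => j'; rewrite IHt //; lia.
  by rewrite eq_g.
have lt_T : T + 0 < T.+2 by lia.
apply/negPn/negP => rej.
have := tabl (th := final_kind (cstate (run M [:: x; y] T))) (ltn0Sn _) (ltn0Sn _) rej.
by rewrite /= tauE // eqxx.
Qed.

End RunOfTableau.

End Tableau.

(** * Numbering the variables, values and clauses of the tableau *)

Definition rank (K : finType) (a : K) : nat := index a (enum K).

Lemma rank_lt (K : finType) (a : K) : rank a < #|K|.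
Proof. by rewrite /rank cardE index_mem mem_enum. Qed.

Lemma nth_rank (K : finType) (a0 a : K) : nth a0 (enum K) (rank a) = a.
Proof. by rewrite nth_index ?mem_enum. Qed.

Lemma rank_nth (K : finType) (a0 : K) k : k < #|K| -> rank (nth a0 (enum K) k) = k.
Proof. by move=> lt_k; rewrite /rank index_uniq ?enum_uniq // -cardE. Qed.

Lemma rank_inj (K : finType) : injective (@rank K).
Proof. by move=> a b eq_ab; rewrite -(nth_rank a a) eq_ab nth_rank. Qed.

Section Encoding.
Variables (M : tm) (c d e f : nat).

Definition certificate_bound (x : seq bool) : nat := poly_bound e f (size x).
Definition time_bound (x : seq bool) : nat := poly_bound c d (size x + certificate_bound x).

Local Notation Y := certificate_bound.
Local Notation T := time_bound.
Local Notation nJ := #|track_index M|.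
Local Notation nV := #|entry M|.
Local Notation nK := #|clause_kind M|.

Definition cell_code (R t : nat) (j : track_index M) (p : nat) : nat := (t * nJ + rank j) * R + p.

Definition literal_code (R : nat) (l : nat * track_index M * nat * entry M) : nat :=
  let: (t, j, p, v) := l in cell_code R t j p * nV + rank v.

(** A clause number packs row, position and kind. An inactive clause receives every literal and is
    thus satisfied by any assignment, so the numbering need not skip it. *)
Definition clause_inc (x : seq bool) : rel nat := fun z b =>
  let R := (T x).+2 in
  let t := z %/ nK %/ R in let p := z %/ nK %% R in
  has (fun th : clause_kind M => (z %% nK == rank th) &&
         (active x (Y x) (T x) th t p ==>
          has (fun l => b == literal_code R l) (literals (T x) th t p)))
    (enum (clause_kind M)).

Lemma entry_card : 1 < nV.
Proof. by rewrite card_sum card_option card_sum card_bool; lia. Qed.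

Lemma track_card : 0 < nJ.
Proof. by rewrite card_option. Qed.

Lemma literal_lt x (th : clause_kind M) t p t' j p' v : active x (Y x) (T x) th t p -> p < (T x).+2 ->
  (t', j, p', v) \in literals (T x) th t p -> (t' < (T x).+2) && (p' < (T x).+2).
Proof.
case: th => [[[[[[j0 k] g] [[[a1 a2] a3] a4]]|[j0 v0]]|[i b]]|q] /= act lt_p.
- case/and4P: act => le_t le_p _ _; rewrite !inE.
  case/or4P=> [/eqP[-> _ -> _]|/eqP[-> _ -> _]|/eqP[-> _ -> _]|]; try lia.
  by case/orP=> [/eqP[-> _ -> _]|/mapP[j' _ [-> _ -> _]]]; lia.
- by rewrite inE => /eqP[-> _ -> _].
- by rewrite !inE => /orP[] /eqP[-> _ -> _]; case/andP: act; lia.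
- by rewrite inE => /eqP[-> _ -> _]; lia.
Qed.

Lemma satisfiable_tableau x (R := (T x).+2) :
  satisfiable (R * nJ * R) nV (R * R * nK) (clause_inc x) <->
  exists tau, @tableau M x (Y x) (T x) tau.
Proof.
have nV1 := entry_card; have nJ0 := track_card.
have nV0 : 0 < nV by lia.
have R0 : 0 < R by [].
have v0 : entry M := inl (start M).
have code_div l : literal_code R l %/ nV = let: (t, j, p, v) := l in cell_code R t j p.
  by case: l => [[[t j] p] v]; rewrite /= divnMDl // divn_small ?addn0 // rank_lt.
have code_mod l : literal_code R l %% nV = rank l.2.
  by case: l => [[[t j] p] v]; rewrite /= modnMDl modn_small // rank_lt.
have cell_lt t j p : t < R -> p < R -> cell_code R t j p < R * nJ * R.
  move=> lt_t lt_p; rewrite /cell_code; have lt_j := rank_lt j.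
  have : t * nJ + rank j < R * nJ by nia.
  by nia.
split=> [[sigma sigma_lt sat]|[tau tabl]].
  exists (fun t j p => nth v0 (enum (entry M)) (sigma (cell_code R t j p))) => t p th lt_t lt_p act.
  have lt_th := rank_lt th.
  have [|b lt_b] := sat ((t * R + p) * nK + rank th).
    have : t * R + p < R * R by rewrite /R in lt_p lt_t *; nia.
    by rewrite /R; nia.
  set z := _ * nK + _.
  have div_z : z %/ nK = t * R + p by rewrite divnMDl ?divn_small ?addn0 //; lia.
  have mod_z : z %% nK = rank th by rewrite modnMDl modn_small.
  have div_tp : (t * R + p) %/ R = t by rewrite divnMDl // divn_small // addn0.
  have mod_tp : (t * R + p) %% R = p by rewrite modnMDl modn_small.
  rewrite /clause_inc -/R div_z mod_z div_tp mod_tp.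
  case/andP=> /hasP[th' _ /andP[/eqP /rank_inj <-]]; rewrite act => /hasP[l l_in /eqP eq_b] viol.
  apply/hasP; exists l => //; rewrite eq_b code_div code_mod in viol.
  case: l l_in eq_b viol => [[[t' j] p'] v] /= l_in eq_b; apply: contraNneq => <-.
  have lt_u : cell_code R t' j p' < R * nJ * R.
    by case/andP: (literal_lt act lt_p l_in); apply: cell_lt.
  by rewrite rank_nth ?sigma_lt.
pose j0 : track_index M := None.
pose sigma u := rank (tau (u %/ R %/ nJ) (nth j0 (enum (track_index M)) (u %/ R %% nJ)) (u %% R)).
have sigmaE t j p : p < R -> sigma (cell_code R t j p) = rank (tau t j p).
  move=> lt_p; rewrite /sigma /cell_code modnMDl (modn_small lt_p).
  rewrite divnMDl // (divn_small lt_p) addn0 modnMDl modn_small ?rank_lt // nth_rank.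
  by rewrite divnMDl // divn_small ?rank_lt // addn0.
exists sigma => [u _|z lt_z]; first exact: rank_lt.
have nK0 : 0 < nK by move: lt_z; case: nK; rewrite ?muln0.
pose th0 : clause_kind M := inr (start M).
pose th := nth th0 (enum (clause_kind M)) (z %% nK).
have rank_th : rank th = z %% nK by rewrite rank_nth ?ltn_mod.
pose t := z %/ nK %/ R; pose p := z %/ nK %% R.
have lt_p : p < R by rewrite ltn_mod.
have lt_t : t < R by rewrite !ltn_divLR.
case act : (active x (Y x) (T x) th t p); last first.
  (* Codes 0 and 1 are literals of variable 0 with different values, since there are at least two
     values; at least one of them is violated. *)
  exists (if sigma 0 == 0 then 1 else 0); first by case: ifP => _; rewrite /R; nia.
  apply/andP; split.
    by apply/hasP; exists th; rewrite ?mem_enum // rank_th eqxx /= -/R -/t -/p act.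
  case: ifP => [/eqP sigma0|sigma0]; last by rewrite div0n mod0n sigma0.
  by rewrite divn_small // sigma0 modn_small.
have /hasP[l l_in viol] := tabl t p th lt_t lt_p act.
exists (literal_code R l).
  case: l l_in {viol} => [[[t' j] p'] v] l_in /=.
  have /andP[lt_t' lt_p'] := literal_lt act lt_p l_in.
  apply: (@leq_trans ((cell_code R t' j p').+1 * nV)); last by rewrite leq_mul2r cell_lt // orbT.
  by rewrite mulSn addnC ltn_add2r rank_lt.
apply/andP; split.
  apply/hasP; exists th; rewrite ?mem_enum // rank_th eqxx /= -/R -/t -/p act.
  by apply/hasP; exists l.
rewrite code_div code_mod; case: l l_in viol => [[[t' j] p'] v] l_in /=.
have /andP[lt_t' lt_p'] := literal_lt act lt_p l_in.
by rewrite sigmaE //; apply: contraNN => /eqP/rank_inj ->.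
Qed.

Section Decidability.
Variable C : ctx.

Lemma ptime_certificate_bound : ptime (fun x : C => certificate_bound (tape0 x)).
Proof.
exact: (ptime_add (ptime_mul (ptime_const C e) (ptime_exp f (ptime_size0 C))) (ptime_const C e)).
Qed.

Lemma ptime_time_bound : ptime (fun x : C => time_bound (tape0 x)).
Proof.
exact: (ptime_add (ptime_mul (ptime_const C c) (ptime_exp d
  (ptime_add (ptime_size0 C) ptime_certificate_bound))) (ptime_const C c)).
Qed.

Lemma ptime_literal_code (R t p : C -> nat) j v : ptime R -> ptime t -> ptime p ->
  ptime (fun x => literal_code (R x) (t x, j, p x, v)).
Proof.
move=> pR pt pp; apply: ptime_add (ptime_const C _).
apply: ptime_mul (ptime_const C _); apply: ptime_add => //; apply: ptime_mul => //.
exact: (ptime_add (ptime_mul pt (ptime_const C _)) (ptime_const C _)).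
Qed.

Variables (t p : C -> nat).
Hypotheses (pt : ptime t) (pp : ptime p).

Lemma pdecidable_start_entry j v :
  pdecidable (fun x => @start_entry M (tape0 x) (certificate_bound (tape0 x)) j v (p x)).
Proof.
have p_blank := pdecidable_leq (ptime_size0 C) pp.
have p_size := pdecidable_ltn pp (ptime_size0 C).
have p_Y := pdecidable_ltn pp ptime_certificate_bound.
case: j => [[i side]|]; last exact: pdecidable_const.
case: v => [q|[[b|a]|]]; try by case: side; apply: pdecidable_const.
  case: side; first exact: pdecidable_const.
  apply: (pdecidable_if (P := fun=> i == 0 :> nat)); first exact: pdecidable_const.
    exact: (pdecidable_and p_size (pdecidable_eqb (pdecidable_nth0 pp) (pdecidable_const C b))).
  exact: (pdecidable_and (pdecidable_const C _) p_Y).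
have p_or := pdecidable_or (pdecidable_const C (side || (i != 0 :> nat))) p_blank.
by case: side p_or.
Qed.

Lemma pdecidable_active th :
  pdecidable (fun x => @active M (tape0 x) (certificate_bound (tape0 x)) (time_bound (tape0 x)) th (t x) (p x)).
Proof.
have p_le := pdecidable_leq pp ptime_time_bound.
case: th => [[[[[[j k] g] [[[a b] a'] v]]|[j v]]|[i b]]|q].
- apply: pdecidable_and; first exact: (pdecidable_leq pt ptime_time_bound).
  apply: pdecidable_and => //; apply: pdecidable_and; last exact: pdecidable_const.
  exact: (pdecidable_eqn (ptime_minn pp (ptime_const C 2)) (ptime_const C k)).
- exact: (pdecidable_not (pdecidable_start_entry j v)).
- exact: (pdecidable_and p_le (pdecidable_const C _)).
- exact: pdecidable_const.
Qed.

Lemma pdecidable_literals (R b : C -> nat) th : ptime R -> ptime b ->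
  pdecidable (fun x => has (fun l => b x == literal_code (R x) l)
    (@literals M (time_bound (tape0 x)) th (t x) (p x))).
Proof.
move=> pR pb.
have p_lit t' p' j v : ptime t' -> ptime p' ->
    pdecidable (fun x => b x == literal_code (R x) (t' x, j, p' x, v)).
  by move=> pt' pp'; apply: pdecidable_eqn => //; apply: ptime_literal_code.
have p0 := ptime_const C 0; have p1 := ptime_succ pp.
have p_false := pdecidable_const C false.
case: th => [[[[[[j k] g] [[[a1 a2] a3] a4]]|[j v]]|[i s]]|q].
- pose tail x := has (fun j' => b x == literal_code (R x) (t x, j', 0, g j')) (enum (track_index M)).
  have p_tail : pdecidable tail.
    by apply: pdecidable_has_seq => j' _; apply: p_lit.
  have p_all := pdecidable_or (p_lit _ _ j a1 pt (ptime_pred pp)) (pdecidable_or (p_lit _ _ j a2 pt pp)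
    (pdecidable_or (p_lit _ _ j a3 pt p1) (pdecidable_or (p_lit _ _ j a4 (ptime_succ pt) pp) p_tail))).
  by apply: pdecidable_ext p_all => x; rewrite /tail /= has_map.
- exact: (pdecidable_or (p_lit _ _ j v p0 pp) p_false).
- exact: (pdecidable_or (p_lit _ _ _ _ p0 pp) (pdecidable_or (p_lit _ _ _ _ p0 p1) p_false)).
- exact: (pdecidable_or (p_lit _ _ _ _ ptime_time_bound p0) p_false).
Qed.

End Decidability.

(** The disjunction over clause kinds has a length fixed by the machine. It is unfolded in the
    program, and the entries and ranks inside each disjunct are constants. *)
Lemma pdecidable_clause_inc (C : ctx) (z b : C -> nat) : ptime z -> ptime b ->
  pdecidable (fun x => clause_inc (tape0 x) (z x) (b x)).
Proof.
move=> pz pb; apply: pdecidable_has_seq => th _.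
have pR := ptime_succ (ptime_succ (ptime_time_bound C)).
have pz' := ptime_divn pz (ptime_const C nK).
apply: pdecidable_and; first exact: (pdecidable_eqn (ptime_modn pz (ptime_const C nK)) (ptime_const C _)).
apply: pdecidable_imply.
  exact: (pdecidable_active (ptime_divn pz' pR) (ptime_modn pz' pR)).
exact: (pdecidable_literals (ptime_divn pz' pR) (ptime_modn pz' pR)).
Qed.

End Encoding.

Theorem cf_overlap_NP_hard : NP_hard cf_overlap_language.
Proof.
move=> A [M [c [d [e [f [halt AM]]]]]].
pose T := time_bound c d e f; pose R x := (T x).+2.
have pR (C : ctx) : ptime (fun x : C => R (tape0 x)).
  exact: (ptime_succ (ptime_succ (ptime_time_bound c d e f C))).
apply: (@satisfiable_reduction A (fun x => R x * #|track_index M| * R x) (fun=> #|entry M|)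
  (fun x => R x * R x * #|clause_kind M|) (@clause_inc M c d e f)).
- move=> C; exact: (ptime_mul (ptime_mul (pR C) (ptime_const C _)) (pR C)).
- by move=> C; apply: ptime_const.
- move=> C; exact: (ptime_mul (ptime_mul (pR C) (pR C)) (ptime_const C _)).
- by move=> C F G; apply: pdecidable_clause_inc.
- by move=> x; have := entry_card M; have := track_card M; rewrite /R; nia.
move=> x; rewrite AM satisfiable_tableau.
(* The tableau needs one number of rows for all certificates. A run on a shorter certificate has
   halted earlier and stays where it is. *)
have final y : size y <= certificate_bound e f x ->
    run M [:: x; y] (T x) = run M [:: x; y] (poly_bound c d (size x + size y)).
  move=> le_y; apply: run_halted; first exact: halt.
  rewrite /T /time_bound /poly_bound leq_add2r leq_mul2l; apply/orP; right.
  by case: (d) => // d'; rewrite leq_exp2r // leq_add2l.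
split=> [[y [le_y acc]]|[tau tabl]].
  by exists (fun t => track (run M [:: x; y] t)); apply: tableau_of_run; rewrite ?final.
have [y le_y acc] := run_of_tableau tabl.
by exists y; split=> //; rewrite -final.
Qed.

(** * Membership in NP *)

Definition bit_value (s : seq bool) : nat := foldr (fun (b : bool) k => b + k.*2) 0 s.

Lemma binary_cons (b : bool) k : 0 < b + k.*2 -> binary (b + k.*2) = b :: binary k.
Proof.
move=> pos; rewrite /binary up_log2S // half_bit_double.
rewrite /mkseq /= -[1]/(1 + 0) iotaDl -map_comp divn1 oddD odd_double addbF oddb.
congr (_ :: _); apply: eq_map => i /=.
by rewrite expnS divnMA divn2 half_bit_double.
Qed.

(** No leading zeros, the most significant bit being last. The default [true] admits the empty
    string, which is [binary 0]. *)
Definition canonical_bits (s : seq bool) : bool := last true s.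

Lemma binary_bit_value s : canonical_bits s -> binary (bit_value s) = s.
Proof.
elim: s => [|b s IH] /=; first by [].
case: s IH => [|b' s] IH last_s; first by move: last_s; rewrite /canonical_bits /= => ->.
have {IH} eq_s : binary (bit_value (b' :: s)) = b' :: s by apply: IH.
rewrite binary_cons; first by rewrite eq_s.
by case: (bit_value _) eq_s => // k; lia.
Qed.

Lemma canonical_binary k : canonical_bits (binary k).
Proof.
elim/ltn_ind: k => k IH; case: (posnP k) => [->|k0] //.
have kE := odd_double_half k.
have lt_k : k./2 < k by rewrite -{2}kE; lia.
rewrite -kE binary_cons ?kE //.
case: (posnP k./2) => [k20|k20].
  by rewrite k20 /= -kE k20 addn0 in k0 *; case: (odd k) k0.
have := IH _ lt_k; rewrite /canonical_bits /=.
by rewrite -[in X in binary X](odd_double_half k./2) binary_cons ?odd_double_half.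
Qed.

Lemma bit_value_binary k : bit_value (binary k) = k.
Proof. by apply: binary_inj; apply: binary_bit_value; apply: canonical_binary. Qed.

Lemma flatten_rows (f : nat -> nat -> bool) r n :
  flatten [seq mkseq (f i) n | i <- iota 0 r] = mkseq (fun q => f (q %/ n) (q %% n)) (r * n).
Proof.
elim: r => [|r IH]; first by [].
rewrite iota0_rcons map_rcons flatten_rcons IH mulSnr /mkseq iotaD map_cat; congr (_ ++ _).
rewrite -[r * n in RHS]addn0 -[0 + _]addnC iotaDl -map_comp.
apply/eq_in_map => j; rewrite mem_iota /= => lt_j.
have n0 : 0 < n by lia.
by rewrite addn0 divnMDl // modnMDl divn_small // modn_small // addn0.
Qed.

(** * Decoding instances *)

Section Decode.
Variable x : seq bool.

Definition dec_order : nat := index false x.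
Definition dec_adj : rel nat := fun i j => nth false x (dec_order.+1 + (i * dec_order + j)).
Definition dec_offset : nat := dec_order.+1 + dec_order * dec_order.

(** The second conjunct is [canonical_bits] of the binary part; it makes well-formed strings exactly
    the encodings. *)
Definition well_formed : bool :=
  [&& dec_offset <= size x, (size x == dec_offset) || nth false x (size x).-1
    & all (fun i => ~~ dec_adj i i && all (fun j => dec_adj i j == dec_adj j i) (iota 0 dec_order))
        (iota 0 dec_order)].

Definition encodes (G : graph) (k : nat) : Prop :=
  [/\ dec_order = order G, forall i j : 'I_(order G), adj i j = dec_adj i j
    & drop dec_offset x = binary k].

End Decode.

Lemma encode_instanceE n (e : rel nat) sym irr k :
  encode_instance (@Graph n (fun i j => e i j) sym irr, k) =
  nseq n true ++ false :: mkseq (fun q => e (q %/ n) (q %% n)) (n * n) ++ binary k.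
Proof.
rewrite /encode_instance /= -flatten_rows -val_enum_ord -map_comp; congr (_ ++ false :: flatten _ ++ _).
by apply: eq_map => i /=; rewrite /mkseq -val_enum_ord -map_comp.
Qed.

Lemma nth_last_true (s : seq bool) : canonical_bits s = (s == [::]) || nth false s (size s).-1.
Proof. by case: s => // b s; rewrite /canonical_bits /= (last_nth false). Qed.

Lemma encode_encodes G k : encodes (encode_instance (G, k)) G k /\ well_formed (encode_instance (G, k)).
Proof.
set x := encode_instance _; case: G @x => n a sym irr x.
(* Adjacency extended to all naturals, so that the flattened matrix can be indexed by quotient and
   remainder. *)
pose e i j := if insub i is Some u then if insub j is Some v then a u v else false else false.
have eE (i j : 'I_n) : e i j = a i j by rewrite /e !valK.
have xE : x = nseq n true ++ false :: mkseq (fun q => e (q %/ n) (q %% n)) (n * n) ++ binary k.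
  rewrite /x /encode_instance /= -flatten_rows -val_enum_ord -map_comp; congr (_ ++ false :: flatten _ ++ _).
  apply: eq_map => i /=; rewrite /mkseq -val_enum_ord -map_comp; apply: eq_map => j /=.
  by rewrite eE.
have order_x : dec_order x = n.
  by rewrite /dec_order xE index_cat mem_nseq andbF size_nseq /= addn0.
have adj_x i j : i < n -> j < n -> dec_adj x i j = e i j.
  move=> lt_i lt_j; rewrite /dec_adj order_x xE nth_cat size_nseq addSn ltnNge leqW ?leq_addr //=.
  rewrite subSn ?leq_addr // addKn /= nth_cat size_mkseq.
  have lt_ij : i * n + j < n * n by nia.
  by rewrite lt_ij nth_mkseq // divnMDl ?modnMDl ?divn_small ?modn_small ?addn0 //; lia.
have offset_x : dec_offset x = n.+1 + n * n by rewrite /dec_offset order_x.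
have drop_x : drop (dec_offset x) x = binary k.
  rewrite offset_x xE -cat_cons catA drop_size_cat //.
  by rewrite size_cat size_nseq /= size_mkseq addnS addSn.
split; first by split=> // i j; rewrite adj_x // eE.
have size_x : size x = dec_offset x + size (binary k).
  rewrite offset_x xE size_cat size_nseq /= size_cat size_mkseq; lia.
apply/and3P; split; first by rewrite size_x leq_addr.
  have := canonical_binary k; rewrite nth_last_true -size_eq0 size_x.
  case: (posnP (size (binary k))) => [->|k0]; first by rewrite addn0 eqxx.
  rewrite orFb -[X in nth _ X _]drop_x nth_drop => last_k.
  by rewrite (_ : (_ + size _).-1 = dec_offset x + (size (binary k)).-1) ?last_k ?orbT //; lia.
apply/allP => i; rewrite mem_iota order_x /= => lt_i.
rewrite adj_x // (eE (Ordinal lt_i) (Ordinal lt_i)) irr /=.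
apply/allP => j; rewrite mem_iota /= => lt_j.
by rewrite !adj_x // (eE (Ordinal lt_i) (Ordinal lt_j)) (eE (Ordinal lt_j) (Ordinal lt_i)) sym.
Qed.

Lemma cat_index_false x : dec_order x < size x ->
  x = nseq (dec_order x) true ++ false :: drop (dec_order x).+1 x.
Proof.
rewrite /dec_order; elim: x => [|[] x IH] //=.
  by rewrite ltnS => /IH {1}->.
by rewrite drop0.
Qed.

Lemma well_formed_encodes x : well_formed x ->
  exists G k, encode_instance (G, k) = x /\ encodes x G k.
Proof.
case/and3P=> le_off last_x /allP adj_ok.
pose n := dec_order x; pose e i j := [&& i < n, j < n & dec_adj x i j].
have mem_ord (i : 'I_n) : nat_of_ord i \in iota 0 n by rewrite mem_iota ltn_ord.
have sym : symmetric (fun i j : 'I_n => e i j).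
  move=> i j; rewrite /e !ltn_ord /=.
  by have /andP[_ /allP sym_i] := adj_ok i (mem_ord i); apply/eqP/sym_i.
have irr : irreflexive (fun i j : 'I_n => e i j).
  move=> i; rewrite /e !ltn_ord /=; apply/negbTE.
  by have /andP[] := adj_ok i (mem_ord i).
pose G := @Graph n _ sym irr; pose k := bit_value (drop (dec_offset x) x).
have kE : binary k = drop (dec_offset x) x.
  apply: binary_bit_value; rewrite nth_last_true -size_eq0 size_drop.
  case/orP: last_x => [/eqP ->|last_x]; first by rewrite subnn.
  case: (posnP (size x - dec_offset x)) => //= gt0.
  by rewrite nth_drop (_ : _ + _ = (size x).-1) //; lia.
suff xE : encode_instance (G, k) = x.
  by exists G, k; split=> //; rewrite -{1}xE; apply: (encode_encodes G k).1.
have le1 : n < size x by rewrite /dec_offset -/n in le_off *; lia.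
rewrite [RHS](cat_index_false le1) -/n encode_instanceE kE; congr (_ ++ false :: _).
rewrite -[RHS](cat_take_drop (n * n)) drop_drop; congr (_ ++ _); last by rewrite addnC.
have size_take_x : size (take (n * n) (drop n.+1 x)) = n * n.
  by rewrite size_takel // size_drop; rewrite /dec_offset -/n in le_off; lia.
apply: (@eq_from_nth _ false) => [|q]; rewrite size_mkseq // => lt_q.
have n0 : 0 < n by case: (n) lt_q.
rewrite nth_mkseq // nth_take // nth_drop /e /dec_adj -/n -divn_eq ltn_mod n0.
by rewrite ltn_divLR // lt_q.
Qed.

(** * Incidence matrices as certificates *)

Definition matrix_rep (n m : nat) (a Y : rel nat) : bool :=
  all (fun u => all (fun v => (u == v) ||
    ((a u v == has (fun q => Y u q && Y v q) (iota 0 m)) &&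
     has (fun q => Y u q && ~~ Y v q) (iota 0 m))) (iota 0 n)) (iota 0 n).

Lemma matrix_repP n m a Y : reflect
  (forall u v, u < n -> v < n -> u != v ->
     (a u v = has (fun q => Y u q && Y v q) (iota 0 m)) /\
     has (fun q => Y u q && ~~ Y v q) (iota 0 m))
  (matrix_rep n m a Y).
Proof.
apply: (iffP allP) => [rep u v lt_u lt_v uv|rep u].
  have u_in : u \in iota 0 n by rewrite mem_iota.
  have v_in : v \in iota 0 n by rewrite mem_iota.
  by have := allP (rep u u_in) v v_in; rewrite (negPf uv) /= => /andP[/eqP].
rewrite mem_iota => lt_u; apply/allP => v; rewrite mem_iota => lt_v.
by case: eqVneq => //= uv; have [//|//||-> ->] := rep u v; rewrite ?eqxx.
Qed.

Section Matrix.
Variables (G : graph) (k : nat) (a : rel nat).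
Hypothesis adj_a : forall i j : 'I_(order G), adj i j = a i j.
Let n := order G.
Let m := minn (n * n) k.

Lemma matrix_of_cf : cf_overlap_number (G, k) -> exists Y, matrix_rep n m a Y.
Proof.
case=> U [S [/= rep cf size_S]]; have meet := (cf_overlap_meet cf).1 rep.
case: (ltnP (n * n) k) => [lt_k|le_k].
  (* The representation by ordered pairs again: the element coding [(p, q)] is the edge from [p] to
     [q], or [p] alone if there is no such edge. *)
  exists (fun u q => (q %/ n == u) || (q %% n == u) && a (q %/ n) (q %% n)).
  have -> : m = n * n by rewrite /m; apply/minn_idPl/ltnW.
  have code u v : u < n -> v < n ->
      [/\ u * n + v < n * n, (u * n + v) %/ n = u & (u * n + v) %% n = v].
    move=> lt_u lt_v; split; [nia | rewrite divnMDl; [rewrite divn_small //; lia | lia] |].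
    by rewrite modnMDl modn_small.
  apply/matrix_repP => u v lt_u lt_v uv; split; last first.
    have [lt_q div_q mod_q] := code u u lt_u lt_u.
    by apply/hasP; exists (u * n + u); rewrite ?mem_iota // div_q mod_q eqxx (negPf uv).
  have aE := adj_a (Ordinal lt_u) (Ordinal lt_v).
  have a_sym := adj_a (Ordinal lt_v) (Ordinal lt_u).
  rewrite adj_sym aE /= in a_sym.
  apply/idP/hasP => [a_uv|[q _]].
    have [lt_q div_q mod_q] := code u v lt_u lt_v.
    by exists (u * n + v); rewrite ?mem_iota // div_q mod_q !eqxx a_uv orbT.
  case/andP=> /orP[/eqP q1|/andP[/eqP q1 a1]] /orP[/eqP q2|/andP[/eqP q2 a2]].
  - by rewrite -q1 -q2 eqxx in uv.
  - by rewrite -q1 -q2.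
  - by rewrite a_sym -q1 -q2.
  - by rewrite -q1 -q2 eqxx in uv.
pose W := \bigcup_v S v.
(* With at most [n * n] elements, the columns of the matrix are the elements of the union in the
   order of their enumeration. *)
have size_W : size (enum W) = k by rewrite -cardE.
pose Y u q := if insub u is Some v then
  (if drop q (enum W) is w :: _ then w \in S v else false) else false.
have YE (v : 'I_n) q w : q < k -> Y v q = (nth w (enum W) q \in S v).
  by move=> lt_q; rewrite /Y valK (drop_nth w) // size_W.
have mE : m = k by apply/minn_idPr.
exists Y; apply/matrix_repP => u v lt_u lt_v uv; rewrite mE.
pose u' : 'I_n := Ordinal lt_u; pose v' : 'I_n := Ordinal lt_v.
have uv' : u' != v' by [].
have has_elt (P : pred U) (Q : pred nat) : (forall w, P w -> w \in W) ->
    (forall w q, q < k -> Q q = P (nth w (enum W) q)) ->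
    has Q (iota 0 k) = [exists w, P w].
  move=> PW QP; apply/hasP/existsP => [[q]|[w Pw]].
    rewrite mem_iota => lt_q Qq; case e: (enum W) => [|w l].
      by move: size_W lt_q; rewrite e => <-.
    by exists (nth w (enum W) q); rewrite -QP.
  have w_in : w \in enum W by rewrite mem_enum PW.
  have lt_q : index w (enum W) < k by rewrite -size_W index_mem.
  by exists (index w (enum W)); rewrite ?mem_iota // (QP w) // nth_index.
have S_W w z : w \in S z -> w \in W by move=> w_in; apply/bigcupP; exists z.
split.
  rewrite (has_elt (fun w => (w \in S u') && (w \in S v'))).
  - rewrite -(adj_a u' v') meet //.
    by apply/set0Pn/existsP => -[w w_in]; exists w; move: w_in; rewrite inE.
  - by move=> w /andP[/S_W].
  - by move=> w q lt_q; rewrite -!YE.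
rewrite (has_elt (fun w => (w \in S u') && (w \notin S v'))).
- by have /subsetPn[w w1 w2] := cf u' v' uv'; apply/existsP; exists w; rewrite w1.
- by move=> w /andP[/S_W].
- by move=> w q lt_q; rewrite -!YE.
Qed.

Lemma cf_of_matrix Y : 0 < n -> matrix_rep n m a Y -> cf_overlap_number (G, k).
Proof.
move=> n0 /matrix_repP rep.
(* Empty columns and the elements beyond the matrix are given to vertex 0 alone. A private element
   creates no intersection and no containment, and it brings the union up to all [k] elements. *)
pose used q := (q < m) && has (fun v => Y v q) (iota 0 n).
pose S (v : 'I_n) : {set 'I_k} := [set q : 'I_k | if used q then Y v q else v == 0 :> nat].
have le_mk : m <= k by apply: geq_minr.
have usedE (v : 'I_n) q : q < m -> Y v q -> used q.
  by move=> lt_q Yq; rewrite /used lt_q; apply/hasP; exists (v : nat); rewrite ?mem_iota ?ltn_ord.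
have cf : @containment_free G _ S.
  move=> u v uv; have [_ /hasP[q]] := rep u v (ltn_ord u) (ltn_ord v) uv.
  rewrite mem_iota => lt_q /andP[Yu Yv].
  have lt_qk : q < k by apply: leq_trans le_mk.
  by apply/subsetPn; exists (Ordinal lt_qk); rewrite inE /= (usedE u).
exists 'I_k, S; split=> //=.
  apply/cf_overlap_meet => // u v uv; rewrite adj_a.
  have [-> _] := rep u v (ltn_ord u) (ltn_ord v) uv.
  apply/hasP/set0Pn => [[q]|[q]].
    rewrite mem_iota => lt_q /andP[Yu Yv].
    have lt_qk : q < k by apply: leq_trans le_mk.
    by exists (Ordinal lt_qk); rewrite !inE /= (usedE u) // Yu.
  rewrite !inE; case used_q: (used q).
    by exists (q : nat) => //; rewrite mem_iota; case/andP: used_q.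
  by case/andP=> /eqP u0 /eqP v0; rewrite -(inj_eq val_inj) /= u0 v0 in uv.
rewrite /representation_size (_ : \bigcup_v S v = setT) ?cardsT ?card_ord //.
apply/setP => q; rewrite [RHS]inE; apply/bigcupP.
case used_q: (used q); last by exists (Ordinal n0); rewrite // inE used_q.
case/andP: (used_q) => _ /hasP[v]; rewrite mem_iota => lt_v Yv.
by exists (Ordinal (lt_v : v < n)); rewrite // inE used_q.
Qed.

End Matrix.

Lemma cf_overlap_empty (G : graph) k : order G = 0 -> cf_overlap_number (G, k) <-> k = 0.
Proof.
move=> n0; have no_vertex (v : 'I_(order G)) : False by have := ltn_ord v; rewrite {2}n0.
split=> [[U [S [_ _ /= <-]]]|->].
  by rewrite /representation_size big_pred0 ?cards0 // => v; case: (no_vertex v).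
exists void, (fun=> set0); split=> [u|u|] /=; try by case: (no_vertex u).
by apply/eqP; rewrite -leqn0 -[leqRHS]card_void; apply: max_card.
Qed.

(** Horner evaluation from the most significant bit, truncated at [n * n] in every round to keep the
    accumulator polynomial. Truncating early is sound because doubling and adding a bit never
    decreases the value. *)
Definition capped_size (x : seq bool) : nat :=
  iteri (size x - dec_offset x)
    (fun i acc => minn (dec_order x * dec_order x) (acc + acc + nth false x (size x - i.+1))) 0.

Lemma capped_sizeP x : dec_offset x <= size x ->
  capped_size x = minn (dec_order x * dec_order x) (bit_value (drop (dec_offset x) x)).
Proof.
move=> le_off; rewrite /capped_size; set B := dec_order x * dec_order x.
have cap i : i <= size x - dec_offset x ->
    iteri i (fun i acc => minn B (acc + acc + nth false x (size x - i.+1))) 0 =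
    minn B (bit_value (drop (size x - i) x)).
  elim: i => [|i IH] lt_i; first by rewrite subn0 drop_size minn0.
  rewrite /= IH ?(ltnW lt_i) // (drop_nth false (n := size x - i.+1)); last by lia.
  rewrite (_ : (size x - i.+1).+1 = size x - i) /=; last by lia.
  by move: (bit_value _) => b; lia.
by rewrite cap // subKn.
Qed.

Definition certificate_matrix (y : seq bool) (m : nat) : rel nat :=
  fun u q => nth false y (u * m + q).

(** Padding needs a vertex. Without vertices only size 0 is possible, that is, an empty binary
    part. *)
Definition verifies (x y : seq bool) : bool :=
  well_formed x &&
  if dec_order x == 0 then size x == dec_offset x
  else matrix_rep (dec_order x) (capped_size x) (dec_adj x) (certificate_matrix y (capped_size x)).

Lemma verifies_complete x : cf_overlap_language x ->
  exists y, size y <= poly_bound 1 3 (size x) /\ verifies x y.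
Proof.
case=> -[G k] <-; set x' := encode_instance _ => yes.
have [[order_x adj_x drop_x] wf] := encode_encodes G k.
rewrite -/x' in order_x adj_x drop_x wf.
have le_off : dec_offset x' <= size x' by case/and3P: wf.
have cap_x := capped_sizeP le_off; rewrite drop_x bit_value_binary order_x in cap_x.
have [Y rep] := matrix_of_cf adj_x yes; rewrite -cap_x in rep.
set m := capped_size x' in cap_x rep.
(* The matrix in row-major order; as [m] is at most the square of the order, its length is at most
   the cube of the input length. *)
exists (mkseq (fun r => Y (r %/ m) (r %% m)) (order G * m)); split.
  rewrite size_mkseq /poly_bound; apply: leq_trans (leq_addr _ _); rewrite mul1n.
  have le_m : m <= order G * order G by rewrite cap_x geq_minl.
  have le_n : order G <= size x' by rewrite /dec_offset order_x in le_off; lia.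
  by rewrite expnS leq_mul // (leq_trans le_m) // -mulnn leq_mul.
rewrite /verifies wf /=; case: eqP => [n0|_].
  have /(cf_overlap_empty k) := etrans (esym order_x) n0; case=> [/(_ yes) k0 _].
  have binary0 : binary 0 = [::] by [].
  have := congr1 size drop_x; rewrite k0 binary0 size_drop => e0.
  by rewrite eqn_leq le_off -subn_eq0 e0 eqxx.
move/matrix_repP: rep => rep; rewrite order_x; apply/matrix_repP => u v lt_u lt_v uv.
have eqY w : w < order G -> {in iota 0 m, forall q,
    certificate_matrix (mkseq (fun r => Y (r %/ m) (r %% m)) (order G * m)) m w q = Y w q}.
  move=> lt_w q; rewrite mem_iota /= => lt_q; rewrite /certificate_matrix nth_mkseq; last nia.
  by rewrite divnMDl ?modnMDl ?divn_small ?modn_small ?addn0 //; lia.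
have [aE sep] := rep u v lt_u lt_v uv; split.
  rewrite aE; apply: eq_in_has => q q_in; by rewrite !eqY.
by rewrite (eq_in_has (a2 := fun q => Y u q && ~~ Y v q)) // => q q_in; rewrite !eqY.
Qed.

Lemma verifies_sound x y : verifies x y -> cf_overlap_language x.
Proof.
case/andP=> wf ver; have [G [k [xE [order_x adj_x drop_x]]]] := well_formed_encodes wf.
exists (G, k) => //.
have le_off : dec_offset x <= size x by case/and3P: wf.
have cap_x := capped_sizeP le_off; rewrite drop_x bit_value_binary order_x in cap_x.
move: ver; rewrite cap_x order_x; case: eqP => [n0 /eqP size_x|/eqP n0].
  apply/cf_overlap_empty => //; rewrite -(bit_value_binary k) -drop_x.
  by rewrite -size_x drop_size.
by apply: cf_of_matrix => //; rewrite lt0n.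
Qed.

(** * Polynomial time of the verifier *)

(** Expresses the unary prefix by counting and a bounded quantifier, both already known to be
    polynomial. *)
Lemma index_false_count x :
  count (fun i => all (fun j => nth false x j) (iota 0 i.+1)) (iota 0 (size x)) = index false x.
Proof.
rewrite (eq_in_count (a2 := fun i => i < index false x)) ?count_ltn_iota ?index_size // => i.
rewrite mem_iota add0n => /andP[_ lt_i]; apply/idP/idP => [all_i|lt_ix].
  rewrite ltnNge; apply/negP => le_i.
  have lt_x : index false x < size x by apply: leq_ltn_trans lt_i.
  have := allP all_i (index false x); rewrite mem_iota ltnS le_i => /(_ isT).
  by rewrite nth_index // -index_mem.
apply/allP => j; rewrite mem_iota add0n => /andP[_ lt_j].
have /(before_find false) : j < index false x by lia.
by case: nth.
Qed.

Section Decidability.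
Variable C : ctx.

Lemma ptime_dec_order : ptime (fun x : C => dec_order (tape0 x)).
Proof.
apply: ptime_ext (fun x => index_false_count (tape0 x)) _.
apply: (@ptime_count_iota C _ (fun z => all (fun j => nth false (tape0 z.1) j) (iota 0 z.2.+1))).
  exact: ptime_size0.
apply: (@pdecidable_all_iota (ext C) (fun z => z.2.+1) (fun w => nth false (tape0 w.1.1) w.2)).
  exact: (ptime_succ (ptime_newest C)).
exact: (@pdecidable_nth0 (ext (ext C)) snd (ptime_newest _)).
Qed.

Lemma ptime_dec_offset : ptime (fun x : C => dec_offset (tape0 x)).
Proof.
exact: (ptime_add (ptime_succ ptime_dec_order) (ptime_mul ptime_dec_order ptime_dec_order)).
Qed.

Lemma pdecidable_dec_adj (F G : C -> nat) : ptime F -> ptime G ->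
  pdecidable (fun x => dec_adj (tape0 x) (F x) (G x)).
Proof.
move=> pF pG; apply: pdecidable_nth0.
exact: (ptime_add (ptime_succ ptime_dec_order) (ptime_add (ptime_mul pF ptime_dec_order) pG)).
Qed.

End Decidability.

Section Verifier.
Variable C : ctx.

Lemma pdecidable_well_formed : pdecidable (fun x : C => well_formed (tape0 x)).
Proof.
have p_size := ptime_size0 C; have p_off := ptime_dec_offset C.
apply: pdecidable_and; first exact: pdecidable_leq.
apply: pdecidable_and.
  exact: (pdecidable_or (pdecidable_eqn p_size p_off) (pdecidable_nth0 (ptime_pred p_size))).
pose C1 := ext C; pose C2 := ext C1.
apply: (@pdecidable_all_iota C _ (fun z => ~~ dec_adj (tape0 z.1) z.2 z.2 &&
  all (fun j => dec_adj (tape0 z.1) z.2 j == dec_adj (tape0 z.1) j z.2) (iota 0 (dec_order (tape0 z.1))))).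
  exact: ptime_dec_order.
apply: pdecidable_and.
  exact: (pdecidable_not (pdecidable_dec_adj (ptime_newest C) (ptime_newest C))).
apply: (@pdecidable_all_iota C1 _ (fun w =>
  dec_adj (tape0 w.1.1) w.1.2 w.2 == dec_adj (tape0 w.1.1) w.2 w.1.2)).
  exact: (ptime_dec_order C1).
have pi : @ptime C2 (fun w => w.1.2) by exact: (ptime_lift (ptime_newest C)).
have pj : @ptime C2 snd by exact: ptime_newest.
exact: (pdecidable_eqb (pdecidable_dec_adj pi pj) (pdecidable_dec_adj pj pi)).
Qed.

Lemma ptime_capped_size : ptime (fun x : C => capped_size (tape0 x)).
Proof.
pose C2 := ext (ext C).
have p_n := ptime_dec_order C; have p_B := ptime_mul p_n p_n.
apply: (@ptime_iter C (fun x => size (tape0 x) - dec_offset (tape0 x)) (fun=> 0)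
  (fun x => dec_order (tape0 x) * dec_order (tape0 x))
  (fun z => minn (dec_order (tape0 z.1.1) * dec_order (tape0 z.1.1))
     (z.2 + z.2 + nth false (tape0 z.1.1) (size (tape0 z.1.1) - z.1.2.+1)))).
- exact: pbounded_value p_B.
- by move=> x [|i] _ //; apply: geq_minl.
- exact: (ptime_sub (ptime_size0 C) (ptime_dec_offset C)).
- exact: ptime_const.
have p_acc : @ptime C2 snd by exact: ptime_newest.
have p_i : @ptime C2 (fun w => w.1.2) by exact: (ptime_lift (ptime_newest C)).
apply: (ptime_minn (ptime_mul (ptime_dec_order C2) (ptime_dec_order C2))).
apply: (ptime_add (ptime_add p_acc p_acc)).
exact: (pdecidable_nth0 (ptime_sub (ptime_size0 C2) (ptime_succ p_i))).
Qed.

Lemma pdecidable_certificate (F G : C -> nat) : ptime F -> ptime G ->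
  pdecidable (fun x => certificate_matrix (tape1 x) (capped_size (tape0 x)) (F x) (G x)).
Proof.
by move=> pF pG; apply: pdecidable_nth1 (ptime_add (ptime_mul pF ptime_capped_size) pG).
Qed.

End Verifier.

Lemma pdecidable_verifies : @pdecidable pair_ctx (fun xy => verifies xy.1 xy.2).
Proof.
pose C1 := ext pair_ctx; pose C2 := ext C1; pose C3 := ext C2.
have p_n (C : ctx) := ptime_dec_order C; have p_m (C : ctx) := ptime_capped_size C.
apply: pdecidable_and; first exact: (pdecidable_well_formed pair_ctx).
apply: pdecidable_if; first exact: (pdecidable_eqn (p_n pair_ctx) (ptime_const _ 0)).
  exact: (pdecidable_eqn (ptime_size0 pair_ctx) (ptime_dec_offset _)).
pose Y (w : C3) := certificate_matrix w.1.1.1.2 (capped_size w.1.1.1.1).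
pose sep (w : C2) := (w.1.2 == w.2) || ((dec_adj w.1.1.1 w.1.2 w.2 ==
    has (fun q => Y (w, q) w.1.2 q && Y (w, q) w.2 q) (iota 0 (capped_size w.1.1.1))) &&
  has (fun q => Y (w, q) w.1.2 q && ~~ Y (w, q) w.2 q) (iota 0 (capped_size w.1.1.1))).
apply: (@pdecidable_all_iota pair_ctx _ (fun z =>
  all (fun v => sep (z, v)) (iota 0 (dec_order z.1.1)))); first exact: (p_n pair_ctx).
apply: (@pdecidable_all_iota C1 _ sep); first exact: (p_n C1).
have pu : @ptime C2 (fun w => w.1.2) by exact: (ptime_lift (ptime_newest pair_ctx)).
have pv : @ptime C2 snd by exact: ptime_newest.
have pYu : @pdecidable C3 (fun w => Y w w.1.1.2 w.2).
  exact: (pdecidable_certificate (ptime_lift pu) (ptime_newest C2)).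
have pYv : @pdecidable C3 (fun w => Y w w.1.2 w.2).
  exact: (pdecidable_certificate (ptime_lift pv) (ptime_newest C2)).
apply: pdecidable_or; first exact: (pdecidable_eqn pu pv).
apply: pdecidable_and.
  apply: pdecidable_eqb; first exact: (pdecidable_dec_adj pu pv).
  exact: (@pdecidable_has_iota C2 _ (fun w => Y w w.1.1.2 w.2 && Y w w.1.2 w.2) (p_m C2)
    (pdecidable_and pYu pYv)).
exact: (@pdecidable_has_iota C2 _ (fun w => Y w w.1.1.2 w.2 && ~~ Y w w.1.2 w.2) (p_m C2)
  (pdecidable_and pYu (pdecidable_not pYv))).
Qed.

Lemma cf_overlap_NP : NP cf_overlap_language.
Proof.
apply: (pdecidable_NP (e := 1) (f := 3) pdecidable_verifies) => x.
by split=> [/verifies_complete|[y [_ /verifies_sound]]].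
Qed.

Theorem theorem20 : NP_complete cf_overlap_language.
Proof. by split; [apply: cf_overlap_NP | apply: cf_overlap_NP_hard]. Qed.
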